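(* Fix constants $\sigma_x>0$, $b>0$, $\gamma\in[0,1)$, $L>0$. There exist constants $c,c',L'>0$ depending only on $\sigma_x,b,\gamma,L$ such that the following holds for every instance of the setting described in the context (all $n<p$, all data distributions with sub-Gaussian norm at most $\sigma_x$, all $\lambda\in\mathbb R$, all $\theta^*\in\mathbb R^p$). Let $k^*=\min\{\kappa\in\{0,\dots,p-1\}:\rho_\kappa>b\}$ (with $k^*=\infty$ if there is no such $\kappa$). Suppose that for some integer $0\le\bar k<n/c$ and some $0\le\delta<1-ce^{-n/c}$: (i) $\lambda>-\gamma\sum_{i>\bar k}\lambda_i$; (ii) with probability at least $1-\delta$ the matrix $A_{\bar k}$ is positive definite with condition number $\mu_1(A_{\bar k})/\mu_n(A_{\bar k})\le L$. Let $k=\min(\bar k,k^* )$. Then with probability at least $1-ce^{-n/c}-\delta$, $$B/c\le\|\theta^*_{k:\infty}\|_{\Sigma_{k:\infty}}^2+\|\theta^*_{0:k}\|_{\Sigma_{0:k}^{-1}}^2\left(\frac{\lambda+\sum_{i>k}\lambda_i}{n}\right)^2,$$ $$V/c\le\frac kn+\frac{n\sum_{i>k}\lambda_i^2}{\left(\lambda+\sum_{i>k}\lambda_i\right)^2}.$$ Moreover, $\rho_k\ge c^{-1}$, $\lambda>-\gamma\sum_{i>k}\lambda_i$, and with probability at least $1-\delta-c'e^{-n/c'}$ the matrix $A_k$ is positive definite with condition number at most $L'$.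
   Context: Setting. $n<p$ are positive integers. $x$ is a random vector in $\mathbb R^p$ with mean zero and covariance $\Sigma=\mathbb E[xx^\top]=\mathrm{diag}(\lambda_1,\dots,\lambda_p)$, $\lambda_1\ge\dots\ge\lambda_p>0$. $X\in\mathbb R^{n\times p}$ is a random matrix with i.i.d. rows distributed as $x^\top$, and $Z=X\Sigma^{-1/2}$. The rows of $Z$ are sub-Gaussian with sub-Gaussian norm at most $\sigma_x$, where for a random variable $\|z\|_{\psi_2}=\inf\{t>0:\mathbb E\exp(z^2/t^2)\le2\}$ and for a random vector $\|z\|_{\psi_2}=\sup_{s\ne0}\|\langle s,z\rangle/\|s\|\|_{\psi_2}$. The ridge parameter is $\lambda\in\mathbb R$ (possibly negative), and $\theta^*\in\mathbb R^p$ is a fixed vector. Notation. $\sum_{i>k}$ means $\sum_{i=k+1}^p$. $\mu_1(M)\ge\dots\ge\mu_m(M)$ are the eigenvalues of a symmetric matrix $M\in\mathbb R^{m\times m}$. $\|v\|_M=\sqrt{v^\top Mv}$ for $M$ positive semidefinite. For $0\le k\le p$, $\theta_{0:k}$ and $\theta_{k:\infty}$ are the vectors of the first $k$ and of the last $p-k$ coordinates of $\theta$; $X_{0:k}$, $X_{k:\infty}$ are the matrices of the first $k$ and the last $p-k$ columns of $X$; $\Sigma_{0:k}=\mathrm{diag}(\lambda_1,\dots,\lambda_k)$, $\Sigma_{k:\infty}=\mathrm{diag}(\lambda_{k+1},\dots,\lambda_p)$. Terms with index $0:k$ are zero when $k=0$. $A=\lambda I_n+XX^\top$, $A_k=\lambda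 I_n+X_{k:\infty}X_{k:\infty}^\top$. For $0\le k\le p-1$, $\rho_k=\frac{1}{n\lambda_{k+1}}\left(\lambda+\sum_{i>k}\lambda_i\right)$. Bias and variance of ridge regression: $B=\|(I_p-X^\top A^{-1}X)\theta^*\|_\Sigma^2$, $V=\mathrm{tr}(A^{-1}X\Sigma X^\top A^{-1})$ when $A$ is invertible; on the event that $A$ is singular, set $B=V=+\infty$. *)

(* Defs.v *)
From mathcomp Require Import all_boot all_order all_algebra.
From mathcomp Require Import all_classical all_reals all_analysis.
Set Implicit Arguments.
Unset Strict Implicit.
Unset Printing Implicit Defensive.
Import Order.TTheory GRing.Theory Num.Theory.
Import numFieldNormedType.Exports.
Local Open Scope classical_set_scope.
Local Open Scope ring_scope.

Definition qform (R : realType) m (M : 'M[R]_m) (v : 'cV[R]_m) : R :=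
  (v^T *m M *m v) 0 0.

Definition mnorm (R : realType) m (M : 'M[R]_m) (v : 'cV[R]_m) : R :=
  Num.sqrt (qform M v).

Definition inner (R : realType) m (s z : 'cV[R]_m) : R := (s^T *m z) 0 0.

(* The norm `|s| of the library on matrices is the sup norm, hence this one. *)
Definition norm2 (R : realType) m (s : 'cV[R]_m) : R := Num.sqrt (inner s s).

(* The nonincreasing sequence of eigenvalues, repeated according to
   multiplicity. It exists for every symmetric M, by the spectral theorem, and
   is then unique; [::] is a dummy value for matrices that are not split. *)
Definition eigvals (R : realType) m (M : 'M[R]_m) : seq R :=
  xget [::] [set s : seq R | sorted >=%R s /\
                             char_poly M = \prod_(a <- s) ('X - a%:P)].

(* Indexed from 1: mu M 1 >= ... >= mu M m. *)
Definition mu (R : realType) m (M : 'M[R]_m) (i : nat) : R := (eigvals M)`_i.-1.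

Definition posdef (R : realType) m (M : 'M[R]_m) : Prop :=
  M^T = M /\ forall v : 'cV[R]_m, v != 0 -> 0 < qform M v.

Definition posdef_cond (R : realType) m (M : 'M[R]_m) (L : R) : Prop :=
  posdef M /\ mu M 1 / mu M m <= L.

(* Index maps of the coordinate blocks 0:k and k:oo, total in k; for k <= p the sizes are k and p - k. *)

Definition head_ord p k (j : 'I_(minn k p)) : 'I_p := widen_ord (geq_minr k p) j.

Lemma tail_ord_subproof p k (j : 'I_(p - k)) : (k + j < p)%N.
Proof. by rewrite -ltn_subRL. Qed.

Definition tail_ord p k (j : 'I_(p - k)) : 'I_p := Ordinal (tail_ord_subproof j).

(* The row ev holds lambda_1, ..., lambda_p in its entries
   ev 0 0, ..., ev 0 (p-1): the 1-based range i > k is k <= i here. *)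

Definition Sigma (R : realType) p (ev : 'rV[R]_p) : 'M[R]_p := diag_mx ev.

Definition Sigma_invsqrt (R : realType) p (ev : 'rV[R]_p) : 'M[R]_p :=
  diag_mx (map_mx (fun t => (Num.sqrt t)^-1) ev).

Definition Sigma_head (R : realType) p (ev : 'rV[R]_p) k : 'M[R]_(minn k p) :=
  diag_mx (colsub (@head_ord p k) ev).

Definition Sigma_tail (R : realType) p (ev : 'rV[R]_p) k : 'M[R]_(p - k) :=
  diag_mx (colsub (@tail_ord p k) ev).

Definition tail_sum (R : realType) p (ev : 'rV[R]_p) (k : nat) : R :=
  \sum_(i < p | (k <= i)%N) ev 0 i.

Definition tail_sum2 (R : realType) p (ev : 'rV[R]_p) (k : nat) : R :=
  \sum_(i < p | (k <= i)%N) ev 0 i ^+ 2.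

(* lambda_(k+1) for k < p; the value 0 is a dummy for k >= p, where rho is not
   defined (rho is then 0). *)
Definition ev_next (R : realType) p (ev : 'rV[R]_p) (k : nat) : R :=
  oapp (fun j : 'I_p => ev 0 j) 0 (insub k).

Definition rho (R : realType) (n : nat) p (ev : 'rV[R]_p) (lam : R) (k : nat) : R :=
  (lam + tail_sum ev k) / (n%:R * ev_next ev k).

(* None stands for k* = +oo. *)
Definition kstar (R : realType) (n : nat) p (ev : 'rV[R]_p) (lam b : R)
    : option 'I_p :=
  [pick j : 'I_p | (b < rho n ev lam j) &&
                   [forall i : 'I_p, (b < rho n ev lam i) ==> (j <= i)%N]].

Definition min_kstar p (kbar : nat) (ks : option 'I_p) : nat :=
  if ks is Some j then minn kbar j else kbar.

Definition Amx (R : realType) n p (lam : R) (X : 'M[R]_(n, p)) : 'M[R]_n :=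
  lam%:M + X *m X^T.

Definition Amx_tail (R : realType) n p (lam : R) (X : 'M[R]_(n, p)) k : 'M[R]_n :=
  Amx lam (colsub (@tail_ord p k) X).

Definition bias (R : realType) n p (ev : 'rV[R]_p) (lam : R) (theta : 'cV[R]_p)
    (X : 'M[R]_(n, p)) : \bar R :=
  let A := Amx lam X in
  if A \in unitmx then
    (mnorm (Sigma ev) ((1%:M - X^T *m invmx A *m X) *m theta) ^+ 2)%:E
  else +oo%E.

Definition variance_term (R : realType) n p (ev : 'rV[R]_p) (lam : R)
    (X : 'M[R]_(n, p)) : \bar R :=
  let A := Amx lam X in
  if A \in unitmx then
    (\tr (invmx A *m X *m Sigma ev *m X^T *m invmx A))%:E
  else +oo%E.

Definition bias_bound (R : realType) (n : nat) p (ev : 'rV[R]_p) (lam : R)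
    (theta : 'cV[R]_p) (k : nat) : R :=
  mnorm (Sigma_tail ev k) (rowsub (@tail_ord p k) theta) ^+ 2 +
  mnorm (invmx (Sigma_head ev k)) (rowsub (@head_ord p k) theta) ^+ 2 *
    ((lam + tail_sum ev k) / n%:R) ^+ 2.

Definition variance_bound (R : realType) (n : nat) p (ev : 'rV[R]_p) (lam : R)
    (k : nat) : R :=
  k%:R / n%:R + n%:R * tail_sum2 ev k / (lam + tail_sum ev k) ^+ 2.

Definition borelM (R : realType) m p : measurableType _ :=
  g_sigma_algebraType (@open 'M[R]_(m, p)).

(* "With probability at least q, the outcome lies in S". Stated through a
   measurable subset of S because P is only meaningful on measurable sets; for
   S measurable this is q%:E <= P S. *)
Definition with_prob d (T : measurableType d) (R : realType)
    (P : probability T R) (q : R) (S : set T) : Prop :=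
  exists E : set T, [/\ measurable E, E `<=` S & (q%:E <= P E)%E].

Definition mutually_independent d (T : measurableType d) (R : realType)
    (P : probability T R) d' (U : measurableType d') n (Y : 'I_n -> T -> U)
    : Prop :=
  forall (J : {set 'I_n}) (E : 'I_n -> set U), (forall i, measurable (E i)) ->
    P (\bigcap_(i in [set` J]) (Y i @^-1` E i)) =
    (\prod_(i in J) P (Y i @^-1` E i))%E.

Definition same_law d (T : measurableType d) d0 (T0 : measurableType d0)
    (R : realType) (P : probability T R) (P0 : probability T0 R)
    d' (U : measurableType d') (Y : T -> U) (Y0 : T0 -> U) : Prop :=
  forall E : set U, measurable E -> P (Y @^-1` E) = P0 (Y0 @^-1` E).

Definition mean_zero d (T : measurableType d) (R : realType)
    (P : probability T R) p (x : T -> 'cV[R]_p) : Prop :=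
  forall i : 'I_p, ('E_P[fun w => x w i 0%R] = 0)%E.

(* E[x x^T] = S; for the diagonal S used here, finiteness of the diagonal makes
   all the expectations in mean_zero and second_moment genuine. *)
Definition second_moment d (T : measurableType d) (R : realType)
    (P : probability T R) p (x : T -> 'cV[R]_p) (S : 'M[R]_p) : Prop :=
  forall i j : 'I_p, ('E_P[fun w => ((x w *m (x w)^T) i j)%R] = (S i j)%:E)%E.

(* +oo when no t qualifies. *)
Definition psi2_norm d (T : measurableType d) (R : realType)
    (P : probability T R) (z : T -> R) : \bar R :=
  ereal_inf [set t%:E | t in [set t : R |
    0 < t /\ ('E_P[fun w => expR (z w ^+ 2 / t ^+ 2)%R] <= 2%:E)%E]].

Definition psi2_norm_vec d (T : measurableType d) (R : realType)
    (P : probability T R) p (z : T -> 'cV[R]_p) : \bar R :=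
  ereal_sup [set psi2_norm P (fun w => inner s (z w) / norm2 s) |
             s in [set s : 'cV[R]_p | s != 0]].

(* Main.v *)
Require Import Defs.
From mathcomp Require Import all_boot all_order all_algebra.
From mathcomp Require Import all_classical all_reals all_analysis.
From mathcomp Require Import measurable_realfun complex.
From mathcomp Require Import ring lra.
Import Order.TTheory GRing.Theory Num.Theory.
Import numFieldNormedType.Exports.
Local Open Scope classical_set_scope.
Local Open Scope ring_scope.
Set Implicit Arguments.
Unset Strict Implicit.
Unset Printing Implicit Defensive.

(** Write A = lam I + X X^T and A_k = lam I + X_tail X_tail^T, where the head of a
    vector of R^p is its first k coordinates. The two matrices differ only through
    the head columns of X. Therefore A^-1 is controlled by the spectrum of A_k,
    which is flat, and by the least singular value of the head block of Z, which is
    of order sqrt n because k is small against n.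

    The deterministic core is [ridge_energy_bounds]. Let A u = X theta and let
    r = theta - X^T u be the error vector. Then A_k u = X r_head + X theta_tail.
    Pairing with u expresses the energy u^T A_k u through theta_head and r_head,
    while the head block of Z being bounded below gives
    n |Sigma^(1/2) r_head|^2 = O(|A_k u - X theta_tail|^2). Each of the two
    quantities u^T A_k u and |Sigma^(1/2) r_head|^2 bounds the other, and Young's
    inequality closes the loop. The head part of the bias is one of them, the tail
    part is at most lambda_(k+1) times a multiple of the other, up to
    |theta_tail|^2 in the metric of Sigma; this uses n lambda_(k+1) = O(S_k), where
    S_k = lam + sum_(i > k) lambda_i ([bias_sum_le]). For the variance one takes for
    theta the head basis vectors, and bounds the tail columns by
    |A^-1 X_j| <= |X_j| / mu_n(A_k) ([var_sum_le]).

    A bounded condition number makes the spectrum of A_kbar flat; its level is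
    tr A_kbar / n, which concentrates around S_kbar ([spectrum_of_cond]). The
    column of index kbar + 1 alone contributes about n lambda_(kbar+1) to the largest
    eigenvalue, so that n lambda_(kbar+1) = O(S_kbar). If k = k* < kbar, the
    definition of k* gives n lambda_(k+1) < S_k / b instead; the columns between k
    and kbar then change neither S_k nor the extreme eigenvalues by more than a
    constant factor ([spectrum_k]).

    On the probabilistic side every quantity is a sum over the n independent rows
    of a convex combination of squares of unit directions of Z. Such a combination
    has mean one and, by convexity, the exponential moment of a single
    sub-Gaussian square, so the exponential Markov inequality bounds both tails
    ([quad_upper], [quad_lower]). Expectations of products over independent rows
    factor by a monotone-class argument from the product rule for events
    ([indep_prod]). The uniform bounds on the head block come from a union bound
    over integer vectors ([head_isometry]). *)

(** * Symmetric matrices and their eigenvalues *)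

Lemma le_of_eq (d : Order.disp_t) (T : porderType d) (x y : T) : x = y -> (x <= y)%O.
Proof. by move=> ->. Qed.

Section LinearAlgebra.
Local Open Scope sesquilinear_scope.
Variable R : realType.

Lemma innerE m (u v : 'cV[R]_m) : inner u v = \sum_i u i 0 * v i 0.
Proof. by rewrite /inner mxE; apply: eq_bigr => i _; rewrite mxE. Qed.

Lemma innerC m (u v : 'cV[R]_m) : inner u v = inner v u.
Proof. by rewrite !innerE; apply: eq_bigr => i _; rewrite mulrC. Qed.

Lemma innerDl m (u v w : 'cV[R]_m) : inner (u + v) w = inner u w + inner v w.
Proof. by rewrite /inner linearD mulmxDl mxE. Qed.

Lemma innerDr m (u v w : 'cV[R]_m) : inner w (u + v) = inner w u + inner w v.
Proof. by rewrite /inner mulmxDr mxE. Qed.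

Lemma innerZl m a (u v : 'cV[R]_m) : inner (a *: u) v = a * inner u v.
Proof. by rewrite /inner linearZ -scalemxAl mxE. Qed.

Lemma innerZr m a (u v : 'cV[R]_m) : inner u (a *: v) = a * inner u v.
Proof. by rewrite innerC innerZl innerC. Qed.

Lemma innerNl m (u v : 'cV[R]_m) : inner (- u) v = - inner u v.
Proof. by rewrite -scaleN1r innerZl mulN1r. Qed.

Lemma innerNr m (u v : 'cV[R]_m) : inner u (- v) = - inner u v.
Proof. by rewrite innerC innerNl innerC. Qed.

Lemma inner_mulmx m n (M : 'M[R]_(m, n)) u v :
  inner u (M *m v) = inner (M^T *m u) v.
Proof. by rewrite /inner trmx_mul trmxK mulmxA. Qed.

Lemma inner_ge0 m (u : 'cV[R]_m) : 0 <= inner u u.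
Proof. by rewrite innerE sumr_ge0 // => i _; rewrite -expr2 sqr_ge0. Qed.

Lemma inner_eq0 m (u : 'cV[R]_m) : (inner u u == 0) = (u == 0).
Proof.
rewrite innerE psumr_eq0; last by move=> i _; rewrite -expr2 sqr_ge0.
apply/idP/eqP => [/allP h|->]; last by apply/allP => i _; rewrite mxE mulr0 eqxx implybT.
apply/matrixP => i j; rewrite ord1 mxE.
by have := h i (mem_index_enum _); rewrite /= mulf_eq0 orbb => /eqP.
Qed.

Lemma inner_gt0 m (u : 'cV[R]_m) : u != 0 -> 0 < inner u u.
Proof. by move=> u0; rewrite lt_neqAle inner_ge0 eq_sym inner_eq0 u0. Qed.

Lemma qformE m (M : 'M[R]_m) v : qform M v = inner v (M *m v).
Proof. by rewrite /qform /inner mulmxA. Qed.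

(** The quadratic polynomial t |-> qform M (u + t v) is nonnegative, hence has
    a nonpositive discriminant. *)
Lemma qform_PSD_CS m (M : 'M[R]_m) u v : M^T = M ->
  (forall w, 0 <= qform M w) ->
  inner u (M *m v) ^+ 2 <= qform M u * qform M v.
Proof.
move=> sM pM.
have sy : inner v (M *m u) = inner u (M *m v) by rewrite inner_mulmx sM innerC.
have key t : 0 <= qform M u + t * 2 * inner u (M *m v) + t ^+ 2 * qform M v.
  have := pM (u + t *: v); rewrite !qformE !(mulmxDr, innerDl, innerDr).
  rewrite -!scalemxAr !(innerZl, innerZr) sy; lra.
have a0 := pM u; have b0 := pM v.
set a := qform M u in key a0 *; set b := qform M v in key b0 *.
set c := inner u _ in key *.
have [b1|b1] := eqVneq b 0.
  have [->|c0] := eqVneq c 0; first by rewrite b1 expr0n mulr0.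
  by have := key (- (a + 1) / (2 * c)); rewrite b1 (_ : _ + _ = -1); [lra|field].
have bp : 0 < b by lra.
have := key (- c / b); rewrite exprMn exprVn.
rewrite [X in _ <= X](_ : _ = (a * b - c ^+ 2) / b); last by field.
by rewrite pmulr_lge0 ?invr_gt0 // subr_ge0.
Qed.

Lemma inner_CS m (u v : 'cV[R]_m) : inner u v ^+ 2 <= inner u u * inner v v.
Proof.
have := @qform_PSD_CS _ 1%:M u v (trmx1 _ _).
rewrite !qformE !mul1mx; apply => w; rewrite qformE mul1mx; exact: inner_ge0.
Qed.

(** Cauchy-Schwarz for the form of M, applied to M v and v, gives
    |M v|^4 <= qform M (M v) * qform M v; the first factor is at most B |M v|^2
    and one |M v|^2 cancels. *)
Lemma qform_PSD_norm m (M : 'M[R]_m) (B : R) v : M^T = M ->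
  (forall w, 0 <= qform M w) -> (forall w, qform M w <= B * inner w w) ->
  inner (M *m v) (M *m v) <= B * qform M v.
Proof.
move=> sM pM uM.
have [z|nz] := eqVneq (inner (M *m v) (M *m v)) 0.
  rewrite z; have [v0|v0] := eqVneq v 0.
    by rewrite v0 qformE mulmx0 /inner mulmx0 mxE mulr0.
  apply: mulr_ge0 (pM v); have := le_trans (pM v) (uM v).
  by rewrite pmulr_lge0 // inner_gt0.
have := qform_PSD_CS (M *m v) v sM pM.
have := uM (M *m v); have := inner_ge0 (M *m v); have := pM v.
move: nz; set x := inner (M *m v) (M *m v); set q := qform M v.
move=> nz q0 x0 h1 h2; have xp : 0 < x by rewrite lt_neqAle eq_sym nz.
have h3 := le_trans h2 (ler_wpM2r q0 h1).
by rewrite -(ler_pM2l xp); apply: le_trans h3 _; lra.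
Qed.

Lemma char_poly_conj (F : comUnitRingType) m (P M : 'M[F]_m) :
  P \in unitmx -> char_poly (invmx P *m M *m P) = char_poly M.
Proof.
move=> Pu; rewrite /char_poly /char_poly_mx !map_mxM.
have PP : map_mx polyC (invmx P) *m map_mx polyC P = 1%:M.
  by rewrite -map_mxM mulVmx // map_mx1.
have -> : 'X%:M = map_mx polyC (invmx P) *m 'X%:M *m map_mx polyC P.
  by rewrite scalar_mxC -mulmxA PP mulmx1.
rewrite -mulmxBl -mulmxBr !det_mulmx mulrAC -det_mulmx PP det1 mul1r.
by congr (\det (_ - _)); rewrite scalar_mxC -mulmxA PP mulmx1.
Qed.

(** Seen over the complex numbers M is Hermitian, hence unitarily diagonal with
    real eigenvalues s. Only the squared moduli c of the coordinates of v in the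
    eigenbasis are kept: they are real, so no real eigenbasis has to be built. *)
Lemma real_spectral m (M : 'M[R]_m) : M^T = M ->
  exists s : 'I_m -> R, char_poly M = \prod_i ('X - (s i)%:P) /\
  forall v : 'cV[R]_m, exists c : 'I_m -> R,
   [/\ forall i, 0 <= c i, \sum_i c i = inner v v &
       qform M v = \sum_i s i * c i].
Proof.
move=> sM.
pose f := real_complex R; pose N := map_mx f M.
have fC t : (f t)^* = f t by apply: conj_Creal; rewrite complex_real.
have Nherm : N \is hermsymmx.
  apply: realsym_hermsym.
    by apply/is_hermitianmxP; rewrite expr0 scale1r map_mx_id // /N map_trmx sM.
  by apply/mxOverP => i j; rewrite mxE complex_real.
set P := spectralmx N; set D := spectral_diag N.
have Preal := hermitian_spectral_diag_real Nherm.
have PU : P \is unitarymx := spectral_unitarymx N.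
have Pu : P \in unitmx := spectral_unit N.
have NE : N = invmx P *m diag_mx D *m P.
  exact/orthomx_spectralP/hermitian_normalmx.
have DE i : D 0 i = f (complex.Re (D 0 i)).
  by have /mxOverP /(_ 0 i) /RRe_real := Preal.
exists (fun i => complex.Re (D 0 i)); split.
  apply: (@map_poly_inj _ _ f).
  rewrite map_char_poly -/N rmorph_prod /=.
  rewrite NE char_poly_conj // char_poly_trig; last exact: diag_mx_is_trig.
  apply: eq_bigr => i _.
  rewrite mxE eqxx mulr1n rmorphB /= map_polyX map_polyC; congr (_ - _%:P).
  exact: DE.
move=> v; pose vc := map_mx f v.
(* y is kept abstract so that entries of y are not expanded into sums. *)
have [y yD] : exists y, y = P *m vc by exists (P *m vc).
have PV : invmx P = P ^t* by exact: invmx_unitary.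
have yE : vc^T *m invmx P = y ^t*.
  rewrite PV yD trmx_mul map_mxM; congr (_ *m _).
  by apply/matrixP => i j; rewrite !mxE; apply/esym/fC.
pose c i := complex.Re (y i 0) ^+ 2 + complex.Im (y i 0) ^+ 2.
have cE i : f (c i) = (y i 0)^* * y i 0.
  by rewrite /f add_Re2_Im2 normCK mulrC.
exists c; split.
- by move=> i; rewrite addr_ge0 // sqr_ge0.
- apply: (@complexI R); rewrite rmorph_sum /=.
  transitivity ((vc^T *m invmx P *m (P *m vc)) 0 0).
    by rewrite yE -yD mxE; apply: eq_bigr => i _; rewrite !mxE -cE.
  rewrite mulmxA mulmxKV // innerE rmorph_sum mxE.
  by apply: eq_bigr => i _; rewrite !mxE rmorphM.
- apply: (@complexI R); rewrite [RHS]rmorph_sum /=.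
  transitivity ((vc^T *m N *m vc) 0 0).
    by rewrite /vc map_trmx -!map_mxM mxE.
  rewrite NE !mulmxA yE -mulmxA -yD -mulmxA mxE; apply: eq_bigr => i _.
  rewrite !mxE (bigD1 i) //= big1 => [|j ji]; last first.
    by rewrite !mxE eq_sym (negPf ji) mulr0n mul0r.
  rewrite addr0 !mxE eqxx mulr1n rmorphM /= -[RHS]/(f _ * f _) cE -DE.
  by rewrite mulrCA.
Qed.

Lemma eigvals_spec m (M : 'M[R]_m) : M^T = M ->
  sorted >=%R (eigvals M) /\
  char_poly M = \prod_(a <- eigvals M) ('X - a%:P).
Proof.
move=> sM; have [s [sE _]] := real_spectral sM.
rewrite /eigvals; case: xgetP => [y -> //|/= none].
have := none (sort >=%R (codom s)); case; split.
  by apply: sort_sorted => a b; exact: le_total.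
rewrite sE; transitivity (\prod_(a <- codom s) ('X - a%:P)).
  by rewrite /codom big_image.
by apply: perm_big; rewrite perm_sym perm_sort.
Qed.

Lemma size_eigvals m (M : 'M[R]_m) : M^T = M -> size (eigvals M) = m.
Proof.
move=> /eigvals_spec[_ /(congr1 (fun p : {poly R} => size p))].
by rewrite size_char_poly size_prod_XsubC => -[].
Qed.

Lemma eigvals_between m (M : 'M[R]_m) a : M^T = M -> a \in eigvals M ->
  mu M m <= a <= mu M 1.
Proof.
move=> sM aM; have [so _] := eigvals_spec sM; have sz := size_eigvals sM.
have [i im <-] := nthP 0 aM.
have tr : transitive (>=%R : rel R) by move=> x y z /[swap]; exact: le_trans.
have re : reflexive (>=%R : rel R) by move=> x; exact: lexx.
rewrite sz in im; have m0 : (0 < m)%N by apply: leq_ltn_trans im.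
rewrite /mu; apply/andP; split.
  apply: (sorted_leq_nth tr re) => //; rewrite ?inE ?sz ?prednK //.
  by rewrite -ltnS prednK.
by apply: (sorted_leq_nth tr re) => //; rewrite inE sz.
Qed.

Lemma qform_mu m (M : 'M[R]_m) v : M^T = M ->
  mu M m * inner v v <= qform M v <= mu M 1 * inner v v.
Proof.
move=> sM; have [s [sE /(_ v)[c [c0 <- ->]]]] := real_spectral sM.
have ins i : mu M m <= s i <= mu M 1.
  apply: eigvals_between => //; rewrite -root_prod_XsubC -(proj2 (eigvals_spec sM)) sE.
  rewrite /root horner_prod (bigD1 i) //=.
  by rewrite !hornerE subrr mul0r.
rewrite !mulr_sumr; apply/andP; split; apply: ler_sum => i _;
  by apply: ler_wpM2r; have /andP[] := ins i.
Qed.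

Lemma eigvals_vec m (M : 'M[R]_m) a : M^T = M -> a \in eigvals M ->
  exists v : 'cV[R]_m, v != 0 /\ qform M v = a * inner v v.
Proof.
move=> sM; rewrite -root_prod_XsubC -(proj2 (eigvals_spec sM)).
rewrite -eigenvalue_root_char => /eigenvalueP[v vM v0].
exists v^T; rewrite trmx_eq0; split=> //.
rewrite qformE -{1}sM -trmx_mul vM linearZ /=.
by rewrite innerZr.
Qed.

Lemma mu_vec m (M : 'M[R]_m) i : M^T = M -> (0 < i <= m)%N ->
  exists v : 'cV[R]_m, v != 0 /\ qform M v = mu M i * inner v v.
Proof.
move=> sM /andP[i0 im]; apply: eigvals_vec => //.
by apply: mem_nth; rewrite size_eigvals // prednK.
Qed.

(** With the next lemma, this trades the condition number, which is defined
    through characteristic polynomials, for two-sided bounds on the quadratic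
    form; all estimates on A_k are made on its form. *)
Lemma posdef_condP m (M : 'M[R]_m) (L m0 m1 : R) : (0 < m)%N -> 0 < m0 ->
  M^T = M -> (forall v, m0 * inner v v <= qform M v <= m1 * inner v v) ->
  m1 / m0 <= L -> posdef_cond M L.
Proof.
move=> mpos m0_gt0 sM hM hL; split.
  split=> // v v0; have /andP[h _] := hM v; apply: lt_le_trans h.
  by rewrite mulr_gt0 // inner_gt0.
have [v [v0 vE]] := @mu_vec _ M 1 sM mpos.
have [w [w0 wE]] := @mu_vec _ M m sM (introT andP (conj mpos (leqnn _))).
have h1 : mu M 1 <= m1.
  have /andP[_] := hM v; rewrite vE ler_pM2r // inner_gt0 //.
have h2 : m0 <= mu M m.
  have /andP[+ _] := hM w; rewrite wE ler_pM2r // inner_gt0 //.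
have h3 : m0 <= m1.
  by have /andP[a b] := hM v; have := le_trans a b; rewrite ler_pM2r // inner_gt0.
apply: le_trans hL.
have m2 : 0 < mu M m by apply: lt_le_trans h2.
apply: (@le_trans _ _ (m1 / mu M m)).
  by rewrite ler_pM2r // invr_gt0.
by rewrite ler_pM2l ?lef_pV2 ?posrE //; apply: lt_le_trans h3.
Qed.

Lemma posdef_cond_bounds m (M : 'M[R]_m) (L : R) : (0 < m)%N ->
  posdef_cond M L -> exists m0 m1, [/\ 0 < m0, m0 <= m1, m1 <= L * m0 &
   forall v, m0 * inner v v <= qform M v <= m1 * inner v v].
Proof.
move=> mpos [[sM pM] hL]; exists (mu M m), (mu M 1).
have [w [w0 wE]] := @mu_vec _ M m sM (introT andP (conj mpos (leqnn _))).
have m0 : 0 < mu M m.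
  by have := pM w w0; rewrite wE pmulr_lgt0 // inner_gt0.
split=> //; last by move=> v; exact: qform_mu.
- by have /andP[a b] := qform_mu w sM; have := le_trans a b; rewrite ler_pM2r // inner_gt0.
- by rewrite -ler_pdivrMr.
Qed.

End LinearAlgebra.

(** * Head and tail coordinates of the ridge system *)

Section Blocks.
Variable R : realType.

Lemma sum_tail_ord p k (F : 'I_p -> R) :
  \sum_(j < p - k) F (tail_ord j) = \sum_(i < p | (k <= i)%N) F i.
Proof.
rewrite -(big_map (@tail_ord p k) xpredT F).
rewrite -[RHS]big_filter; apply: perm_big; apply: uniq_perm.
- rewrite map_inj_uniq ?index_enum_uniq // => i j /(congr1 val) /= /eqP.
  by rewrite eqn_add2l => /eqP/val_inj.
- by rewrite filter_uniq // index_enum_uniq.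
move=> i; rewrite mem_filter mem_index_enum andbT; apply/mapP/idP.
  by move=> [j _ ->]; rewrite leq_addr.
move=> ki; have lt : (i - k < p - k)%N by rewrite ltn_sub2r // (leq_ltn_trans ki).
exists (Ordinal lt); first by rewrite mem_index_enum.
by apply: val_inj; rewrite /= subnKC.
Qed.

Lemma sum_head_ord p k (F : 'I_p -> R) :
  \sum_(j < minn k p) F (head_ord j) = \sum_(i < p | (i < k)%N) F i.
Proof.
rewrite -(big_map (@head_ord p k) xpredT F).
rewrite -[RHS]big_filter; apply: perm_big; apply: uniq_perm.
- by rewrite map_inj_uniq ?index_enum_uniq // => i j /(congr1 val) /= /val_inj.
- by rewrite filter_uniq // index_enum_uniq.
move=> i; rewrite mem_filter mem_index_enum andbT; apply/mapP/idP.
  by move=> [j _ ->]; apply: (leq_trans (ltn_ord j)); exact: geq_minl.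
move=> ik; have lt : (i < minn k p)%N by rewrite leq_min ik ltn_ord.
exists (Ordinal lt); first by rewrite mem_index_enum.
exact: val_inj.
Qed.

(** Vectors of a coordinate block are padded with zeros and stay in R^p, so that
    the blocks of all k share one type. *)
Definition headv p k (v : 'cV[R]_p) : 'cV[R]_p :=
  \col_j (if (j < k)%N then v j 0 else 0).
Definition tailv p k (v : 'cV[R]_p) : 'cV[R]_p :=
  \col_j (if (k <= j)%N then v j 0 else 0).

Lemma headv_tailv p k (v : 'cV[R]_p) : headv k v + tailv k v = v.
Proof.
by apply/matrixP => i j; rewrite !mxE ord1; case: ltnP; rewrite ?addr0 ?add0r.
Qed.

Lemma headvB p k (u v : 'cV[R]_p) : headv k (u - v) = headv k u - headv k v.
Proof. by apply/matrixP => i j; rewrite !mxE; case: ifP; rewrite ?subrr. Qed.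

Lemma inner_headv p k (u v : 'cV[R]_p) :
  inner u (headv k v) = \sum_(j < p | (j < k)%N) u j 0 * v j 0.
Proof.
rewrite innerE [RHS]big_mkcond; apply: eq_bigr => j _; rewrite mxE.
by case: ifP; rewrite ?mulr0.
Qed.

Lemma inner_tailv p k (u v : 'cV[R]_p) :
  inner u (tailv k v) = \sum_(j < p | (k <= j)%N) u j 0 * v j 0.
Proof.
rewrite innerE [RHS]big_mkcond; apply: eq_bigr => j _; rewrite mxE.
by case: ifP; rewrite ?mulr0.
Qed.

Lemma inner_tailvv p k (u v : 'cV[R]_p) :
  inner (tailv k u) (tailv k v) = inner u (tailv k v).
Proof.
rewrite !inner_tailv; apply: eq_bigr => j kj; by rewrite mxE kj.
Qed.

Variables (n p : nat) (X : 'M[R]_(n, p)) (lam : R).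

(** X restricted to its last columns, times its transpose, is X * tailv * X^T. *)
Lemma Amx_tail_mul k (v : 'cV[R]_n) :
  Amx_tail lam X k *m v = lam *: v + X *m tailv k (X^T *m v).
Proof.
rewrite /Amx_tail /Amx mulmxDl mul_scalar_mx; congr (_ + _).
rewrite -mulmxA; apply/matrixP => i j; rewrite ord1 !mxE.
transitivity (\sum_(l < p | (k <= l)%N) X i l * (X^T *m v) l 0).
  rewrite -sum_tail_ord; apply: eq_bigr => l _; rewrite !mxE; congr (_ * _).
  by apply: eq_bigr => i' _; rewrite !mxE.
rewrite big_mkcond; apply: eq_bigr => l _; rewrite [tailv _ _ _ _]mxE.
by case: ifP; rewrite ?mulr0.
Qed.

Lemma Amx_mul (v : 'cV[R]_n) : Amx lam X *m v = lam *: v + X *m (X^T *m v).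
Proof. by rewrite /Amx mulmxDl mul_scalar_mx mulmxA. Qed.

Lemma Amx_split k (v : 'cV[R]_n) :
  Amx lam X *m v = Amx_tail lam X k *m v + X *m headv k (X^T *m v).
Proof.
rewrite Amx_mul Amx_tail_mul -{1}(headv_tailv k (X^T *m v)) mulmxDr.
by rewrite (addrC (X *m headv _ _)) addrA.
Qed.

Lemma Amx_sym m (Y : 'M[R]_(n, m)) : (Amx lam Y)^T = Amx lam Y.
Proof. by rewrite /Amx linearD /= tr_scalar_mx trmx_mul trmxK. Qed.

Lemma Amx_tail_sym k : (Amx_tail lam X k)^T = Amx_tail lam X k.
Proof. exact: Amx_sym. Qed.

Lemma qform_Amx_tail k v : qform (Amx_tail lam X k) v =
  lam * inner v v + \sum_(j < p | (k <= j)%N) ((X^T *m v) j 0) ^+ 2.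
Proof.
rewrite qformE Amx_tail_mul innerDr innerZr inner_mulmx; congr (_ + _).
by rewrite inner_tailv; apply: eq_bigr => j _; rewrite expr2.
Qed.

Lemma qform_Amx_le k v : qform (Amx_tail lam X k) v <= qform (Amx lam X) v.
Proof.
rewrite qform_Amx_tail qformE Amx_mul innerDr innerZr inner_mulmx lerD2l.
rewrite innerE [leLHS]big_mkcond; apply: ler_sum => j _.
by rewrite -expr2; case: ifP => _ //; exact: sqr_ge0.
Qed.

End Blocks.

Section Core.
Variables (R : realType) (n p : nat) (X : 'M[R]_(n, p)) (lam : R) (ev : 'rV[R]_p).
Variables (k : nat) (m0 m1 w : R).
Hypothesis ev_gt0 : forall j, 0 < ev 0 j.
Hypothesis m0_gt0 : 0 < m0.
Hypothesis m01 : m0 <= m1.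
Hypothesis w_gt0 : 0 < w.
Hypothesis hAk : forall v : 'cV[R]_n,
  m0 * inner v v <= qform (Amx_tail lam X k) v <= m1 * inner v v.
Hypothesis hX : forall r : 'cV[R]_p, (forall j : 'I_p, (k <= j)%N -> r j 0 = 0) ->
  w * \sum_j ev 0 j * r j 0 ^+ 2 <= inner (X *m r) (X *m r).

Let A := Amx lam X.
Let Ak := Amx_tail lam X k.

Lemma qform_Amx_tail_ge0 v : 0 <= qform Ak v.
Proof.
have /andP[h _] := hAk v; apply: le_trans h.
by rewrite mulr_ge0 ?inner_ge0 // ltW.
Qed.

Lemma Amx_unitmx : A \in unitmx.
Proof.
rewrite -row_free_unit; apply/row_freeP.
have inj (v : 'rV[R]_n) : v *m A = 0 -> v = 0.
  move=> vA; have sA : A^T = A := Amx_sym lam X.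
  have h : A *m v^T = 0.
    by have := congr1 trmx vA; rewrite trmx_mul trmx0 sA.
  have := qform_Amx_le X lam k v^T; rewrite [leRHS]qformE h.
  rewrite /inner mulmx0 mxE => h1.
  have /andP[h2 _] := hAk v^T; have h3 := le_trans h2 h1.
  have h4 : inner v^T v^T = 0.
    by apply/eqP; rewrite eq_le inner_ge0 andbT -(pmulr_rle0 _ m0_gt0).
  by move/eqP: h4; rewrite inner_eq0 trmx_eq0 => /eqP.
suff : row_free A by move/row_freeP.
rewrite -kermx_eq0; apply/eqP/row_matrixP => i; rewrite row0.
by apply: inj; rewrite -row_mul mulmx_ker row0.
Qed.

(** A dominates A_k as a quadratic form, so |A^-1 h| <= |h| / m0. *)
Lemma Amx_inverse_bound (u h : 'cV[R]_n) : A *m u = h ->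
  m0 ^+ 2 * inner u u <= inner h h.
Proof.
move=> hu; have := qform_Amx_le X lam k u; rewrite [leRHS]qformE -/A hu => h1.
have /andP[h2 _] := hAk u; have h3 := le_trans h2 h1.
have := inner_CS u h; have u0 := inner_ge0 u.
move: h3 u0; set x := inner u u; set y := inner h h; set z := inner u h.
move=> h3 x0 h4; have [->|xn] := eqVneq x 0; first by rewrite mulr0 inner_ge0.
have xp : 0 < x by rewrite lt_neqAle eq_sym xn.
rewrite -(ler_pM2l xp); apply: le_trans h4.
have : 0 <= m0 * x by rewrite mulr_ge0 // ltW.
nra.
Qed.

Variables (theta : 'cV[R]_p) (u : 'cV[R]_n).
Hypothesis hu : A *m u = X *m theta.
Let r := theta - X^T *m u.
Let Q := \sum_(j < p | (j < k)%N) ev 0 j * r j 0 ^+ 2.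
Let Tt := \sum_(j < p | (j < k)%N) theta j 0 ^+ 2 / ev 0 j.
Let h := X *m tailv k theta.
Let H := inner h h.
Let a := qform Ak u.

(** Moving the head columns of A u = X theta to the right-hand side turns
    theta_head into the head of the error vector r. *)
Lemma Amx_tail_error_eq : Ak *m u = X *m headv k r + h.
Proof.
have : Ak *m u = X *m theta - X *m headv k (X^T *m u).
  by rewrite -hu (Amx_split X lam k u) addrK.
move=> ->; rewrite /r headvB /h -{1}(headv_tailv k theta) mulmxBr mulmxDr.
by rewrite addrAC.
Qed.

Lemma head_error_le : w * Q <= inner (X *m headv k r) (X *m headv k r).
Proof.
apply: le_trans (hX _); last first.
  by move=> j kj; rewrite mxE ltnNge kj.
rewrite ler_pM2l // /Q big_mkcond /=; apply: ler_sum => j _.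
rewrite [headv _ _ _ _]mxE.
by case: ifP => _ //; rewrite mulr_ge0 ?sqr_ge0 // ltW.
Qed.

(** Pairing the error equation with u gives the exact identity
    qform Ak u = <theta, r_head> - |r_head|^2 + <u, h>. The first product is
    split by Young's inequality with weight al, coordinatewise in the metric of
    ev, the last one is absorbed into half of qform Ak u. *)
Lemma dual_energy_le (al : R) : 0 < al -> a <= al * Tt + Q / al + H / m0.
Proof.
move=> al0.
have aE : a = inner theta (headv k r) - inner r (headv k r) + inner u h.
  rewrite /a qformE Amx_tail_error_eq innerDr inner_mulmx; congr (_ + _).
  rewrite -innerNl -innerDl; congr (inner _ _).
  by rewrite /r opprB addrC subrK.
have h1 : 2 * inner theta (headv k r) <= al * Tt + Q / al.
  rewrite inner_headv /Tt /Q !mulr_sumr mulr_suml -big_split /=.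
  apply: ler_sum => j _; have e0 := ev_gt0 j.
  set t := theta j 0; set s := r j 0.
  rewrite -subr_ge0 (_ : _ - _ = (al * t - ev 0 j * s) ^+ 2 / (al * ev 0 j)).
    by rewrite divr_ge0 ?sqr_ge0 // mulr_ge0 // ltW.
  by field; rewrite !gt_eqF.
have h2 : 0 <= inner r (headv k r).
  by rewrite inner_headv sumr_ge0 // => j _; rewrite -expr2 sqr_ge0.
have h3 : 2 * inner u h <= m0 * inner u u + H / m0.
  have := inner_ge0 (m0 *: u - h).
  rewrite !(innerDl, innerDr, innerNl, innerNr, innerZl, innerZr) (innerC h u).
  rewrite -/H => h4; rewrite -(ler_pM2l m0_gt0) mulrDr.
  have -> : m0 * (H / m0) = H by field; rewrite gt_eqF.
  lra.
have /andP[h4 _] := hAk u; rewrite -/Ak -/a in h4.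
lra.
Qed.

(** The two unknowns, the head error Q and the energy a of u, bound each other:
    w Q <= |Ak u - h|^2 <= 2 m1 a + 2 H and a <= al Tt + Q / al + H / m0. With
    al = 4 m1 / w the first bound returns only half of w Q, and the system closes. *)
Lemma ridge_energy_bounds :
  Q <= 16 * m1 ^+ 2 * Tt / w ^+ 2 + 4 * (m1 / m0 + 1) * H / w /\
  a <= 8 * m1 * Tt / w + 3 * H / m0.
Proof.
have m1_gt0 : 0 < m1 by apply: lt_le_trans m01.
have w0 : w != 0 by rewrite gt_eqF.
have m1n : m1 != 0 by rewrite gt_eqF.
have m0n : m0 != 0 by rewrite gt_eqF.
have al0 : 0 < 4 * m1 / w by rewrite divr_gt0 // mulr_gt0.
have h1 := dual_energy_le al0.
have h2 : w * Q <= 2 * (m1 * a) + 2 * H.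
  apply: le_trans head_error_le _.
  have -> : X *m headv k r = Ak *m u - h by rewrite Amx_tail_error_eq addrK.
  have h3 := inner_ge0 (Ak *m u + h).
  have h4 : inner (Ak *m u) (Ak *m u) <= m1 * a.
    apply: qform_PSD_norm; [exact: Amx_tail_sym|exact: qform_Amx_tail_ge0|].
    by move=> v; have /andP[] := hAk v.
  move: h3; rewrite !(innerDl, innerDr, innerNl, innerNr, innerZl, innerZr).
  rewrite (innerC h) -/H; lra.
have h3 : w * Q <= 16 * m1 ^+ 2 * Tt / w + 4 * (m1 / m0 + 1) * H.
  have := ler_wpM2l (ltW m1_gt0) h1.
  rewrite (_ : m1 * (_ + _ + _) =
     4 * m1 ^+ 2 * Tt / w + w * Q / 4 + m1 / m0 * H); last by field; rewrite ?m0n ?m1n ?w0 //.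
  rewrite (_ : 16 * _ * _ / _ = 4 * (4 * m1 ^+ 2 * Tt / w)); last by field.
  lra.
have h4 : Q <= 16 * m1 ^+ 2 * Tt / w ^+ 2 + 4 * (m1 / m0 + 1) * H / w.
  rewrite -(ler_pM2l w_gt0); apply: (le_trans h3).
  by apply: le_of_eq; field; rewrite ?m0n ?m1n ?w0 //.
split=> //; apply: (le_trans h1).
have h5 : Q / (4 * m1 / w) <= 4 * m1 * Tt / w + (m0^-1 + m1^-1) * H.
  rewrite (_ : Q / _ = (w * Q) / (4 * m1)); last by field; rewrite ?m0n ?m1n ?w0 //.
  rewrite ler_pdivrMr ?mulr_gt0 //; apply: (le_trans h3).
  apply: le_of_eq; field; rewrite ?m0n ?m1n ?w0 //.
have h6 : m1^-1 <= m0^-1 by rewrite lef_pV2.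
have H0 : 0 <= H := inner_ge0 _.
have h7 := ler_wpM2r H0 h6.
lra.
Qed.
End Core.

(** * Expectations of products over independent variables *)

Section Independence.
Import HBNNSimple.
Context d (T : measurableType d) (R : realType) (P : probability T R)
        d' (U : measurableType d').

Lemma integral_simple_weight (Y : T -> U) (G : T -> R) (g : {nnsfun U >-> R}) :
  measurable_fun setT Y -> measurable_fun setT G -> (forall w, 0 <= G w) ->
  (\int[P]_w (g (Y w) * G w)%:E =
   \sum_(y \in range g) `|y|%:E * \int[P]_w (\1_(g @^-1` [set y]) (Y w) * G w)%:E)%E.
Proof.
move=> mY mG G0.
have mi y : measurable_fun setT (fun w => \1_(g @^-1` [set y]) (Y w) * G w).
  apply: measurable_funM => //.
  by apply: measurableT_comp => //; apply: measurable_indic.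
transitivity (\int[P]_w (\sum_(y \in range g)
    `|y|%:E * (\1_(g @^-1` [set y]) (Y w) * G w)%:E))%E.
  apply: eq_integral => w _; rewrite fimfunE.
  rewrite fsbig_finite //= fsbig_finite //= mulr_suml -sumEFin.
  rewrite big_seq [RHS]big_seq; apply: eq_bigr => y.
  rewrite in_fset_set // inE => -[x _ <-].
  by rewrite -EFinM mulrA ger0_norm.
rewrite ge0_integral_fsum //=.
- apply: eq_fsbigr => y _.
  rewrite ge0_integralZl_EFin //; last exact/measurable_EFinP.
  by move=> w _; rewrite lee_fin mulr_ge0.
- by move=> y; apply/measurable_EFinP; apply: measurable_funM.
- by move=> y w _; rewrite -EFinM lee_fin mulr_ge0 // mulr_ge0.
Qed.

Lemma integral_weight_cvg (Y : T -> U) (G : T -> R) (f : U -> R)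
    (mf : measurable_fun setT (EFin \o f)) :
  measurable_fun setT Y -> measurable_fun setT G -> (forall w, 0 <= G w) ->
  (forall x, 0 <= f x) ->
  (\int[P]_w (nnsfun_approx measurableT mf m (Y w) * G w)%:E @[m --> \oo]
    --> \int[P]_w (f (Y w) * G w)%:E)%E.
Proof.
move=> mY mG G0 f0.
set g := nnsfun_approx measurableT mf.
have gf x : g m x @[m --> \oo] --> f x.
  have /fine_cvg := cvg_nnsfun_approx measurableT mf (fun x _ => f0 x) (x := x) I.
  exact.
rewrite (_ : (\int[P]_w (f (Y w) * G w)%:E =
  \int[P]_w limn (fun m => (g m (Y w) * G w)%:E))%E); last first.
  apply: eq_integral => w _; apply/esym/cvg_lim => //.
  apply: cvg_EFin; first by apply: nearW.
  apply: cvgM; [exact: gf|exact: cvg_cst].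
apply: cvg_monotone_convergence => //.
- move=> m; apply/measurable_EFinP; apply: measurable_funM => //.
  exact: measurableT_comp.
- by move=> m w _; rewrite lee_fin mulr_ge0.
- move=> w _ m1 m2 m12; rewrite lee_fin ler_wpM2r //.
  by have /lefP := nd_nnsfun_approx measurableT mf m12; exact.
Qed.

(** Monotone-class step: two weights that integrate all indicators of events of
    Y in the same way integrate all nonnegative functions of Y in the same way. *)
Lemma integral_weight_ext (Y : T -> U) (G1 G2 : T -> R) (f : U -> R) :
  measurable_fun setT Y -> measurable_fun setT G1 -> measurable_fun setT G2 ->
  (forall w, 0 <= G1 w) -> (forall w, 0 <= G2 w) ->
  (forall E, measurable E ->
    \int[P]_w (\1_E (Y w) * G1 w)%:E = \int[P]_w (\1_E (Y w) * G2 w)%:E)%E ->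
  measurable_fun setT f -> (forall x, 0 <= f x) ->
  (\int[P]_w (f (Y w) * G1 w)%:E = \int[P]_w (f (Y w) * G2 w)%:E)%E.
Proof.
move=> mY mG1 mG2 G10 G20 hE mf f0.
have mf' : measurable_fun setT (EFin \o f) by apply/measurable_EFinP.
have c1 := integral_weight_cvg mf' mY mG1 G10 f0.
have c2 := integral_weight_cvg mf' mY mG2 G20 f0.
suff E : (fun m => \int[P]_w (nnsfun_approx measurableT mf' m (Y w) * G1 w)%:E)%E =
         (fun m => \int[P]_w (nnsfun_approx measurableT mf' m (Y w) * G2 w)%:E)%E.
  by rewrite E in c1; exact: (cvg_unique _ c1 c2).
apply/funext => m; rewrite !integral_simple_weight //.
by apply: eq_fsbigr => y _; rewrite hE.
Qed.

(** Mutual independence is the case where every f i is an indicator. The indices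
    at which f is arbitrary are released one at a time: with the other factors
    collected in a weight G, the weights G and its constant expectation agree on
    indicators, hence on all nonnegative functions. *)
Lemma indep_prod n (Y : 'I_n -> T -> U) :
  (forall i, measurable_fun setT (Y i)) -> mutually_independent P Y ->
  forall (f : 'I_n -> U -> R) (e : 'I_n -> R),
  (forall i, measurable_fun setT (f i)) -> (forall i x, 0 <= f i x) ->
  (forall i, \int[P]_w (f i (Y i w))%:E = (e i)%:E)%E ->
  (\int[P]_w (\prod_i f i (Y i w))%:E = (\prod_i e i)%:E)%E.
Proof.
move=> mY indY.
suff main (s : seq 'I_n) : forall (f : 'I_n -> U -> R) (e : 'I_n -> R),
  (forall i, i \notin s -> exists E, measurable E /\ f i = \1_E) ->
  (forall i, measurable_fun setT (f i)) -> (forall i x, 0 <= f i x) ->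
  (forall i, \int[P]_w (f i (Y i w))%:E = (e i)%:E)%E ->
  (\int[P]_w (\prod_i f i (Y i w))%:E = (\prod_i e i)%:E)%E.
  move=> f e; apply: (main (enum 'I_n)) => i; by rewrite mem_enum.
elim: s => [|i s IH] f e fs mf f0 fe.
  have /choice[E hE] i : exists E, measurable E /\ f i = \1_E by exact: fs.
  have mE i : measurable (Y i @^-1` E i).
    by rewrite -[X in measurable X]setTI; apply: mY => //; exact: (hE i).1.
  have eE i : P (Y i @^-1` E i) = (e i)%:E.
    rewrite -fe (hE i).2 -(setIT (_ @^-1` _)) -integral_indic //.
  have := indY [set: 'I_n]%SET E (fun i => (hE i).1).
  under [X in _ = X]eq_bigr do rewrite eE.
  rewrite -prodEFin; rewrite (eq_bigl xpredT); last by move=> i; rewrite inE.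
  move=> <-; rewrite -[X in P X]setIT -integral_indic //; last first.
    by apply: fin_bigcap_measurable => //; exact: finite_finset.
  apply: eq_integral => w _; congr EFin.
  rewrite (eq_bigr (fun i => \1_(E i) (Y i w))); last by move=> i _; rewrite (hE i).2.
  rewrite indicE; case: (boolP (w \in _)) => [/set_mem h|h] /=.
    by rewrite big1 // => i _; rewrite indicE mem_set //; apply: h; rewrite /= inE.
  have [i hi] : exists i, ~ E i (Y i w).
    apply: contrapT => /forallNP hn; case/negP: h; apply/mem_set => i _.
    exact: contrapT (hn i).
  by rewrite (bigD1 i) //= indicE memNset ?mul0r.
pose G w := \prod_(j | j != i) f j (Y j w).
pose c := \prod_(j | j != i) e j.
have e0 j : 0 <= e j.
  by rewrite -lee_fin -fe; apply: integral_ge0 => w _; rewrite lee_fin.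
have mG : measurable_fun setT G.
  rewrite /G; under eq_fun do rewrite -big_filter.
  by apply: measurable_prod => j _; exact: measurableT_comp.
have G0 w : 0 <= G w by apply: prodr_ge0.
transitivity (\int[P]_w (f i (Y i w) * G w)%:E)%E.
  by apply: eq_integral => w _; rewrite (bigD1 i).
rewrite (@integral_weight_ext (Y i) G (fun=> c)) //; last 2 first.
- by move=> w; apply: prodr_ge0.
- move=> E mE.
  pose f' j := if j == i then (\1_E : U -> R) else f j.
  pose e' j := if j == i then fine (P (Y i @^-1` E)) else e j.
  have mYE : measurable (Y i @^-1` E).
    by rewrite -[X in measurable X]setTI; apply: mY.
  have i1 : (\int[P]_w (\1_E (Y i w))%:E = (fine (P (Y i @^-1` E)))%:E)%E.
    rewrite fineK ?fin_num_measure // -[in RHS](setIT (_ @^-1` _)).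
    by rewrite -integral_indic.
  have h1 : (\int[P]_w (\prod_j f' j (Y j w))%:E = (\prod_j e' j)%:E)%E.
    apply: IH => j.
    - move=> js; rewrite /f'; case: eqVneq => [_|ji]; first by exists E.
      by apply: fs; rewrite inE negb_or ji.
    - by rewrite /f'; case: eqVneq => // _; exact: measurable_indic.
    - by move=> x; rewrite /f'; case: eqVneq.
    - by rewrite /f' /e'; case: eqVneq => // ->.
  transitivity (\int[P]_w (\prod_j f' j (Y j w))%:E)%E.
    apply: eq_integral => w _; rewrite (bigD1 i) //= /f' eqxx.
    by congr (_ * _)%:E; apply: eq_bigr => j /negPf ->.
  rewrite h1 (bigD1 i) //= {1}/e' eqxx.
  under [RHS]eq_integral do rewrite mulrC EFinM.
  rewrite ge0_integralZl_EFin //; last 2 first.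
  + apply/measurable_EFinP; apply: measurableT_comp => //; exact: measurable_indic.
  + by apply: prodr_ge0.
  rewrite i1 -EFinM mulrC; congr (_ * _)%:E.
  by apply: eq_bigr => j /negPf ji; rewrite /e' ji.
under eq_integral do rewrite mulrC EFinM.
rewrite ge0_integralZl_EFin //; last 3 first.
- by move=> w _; rewrite lee_fin.
- by apply/measurable_EFinP; apply: measurableT_comp.
- by apply: prodr_ge0.
by rewrite fe -EFinM mulrC [in RHS](bigD1 i).
Qed.

(** Markov's inequality for the exponential of the sum, which factors by
    independence. *)
Lemma indep_expR_markov n (Y : 'I_n -> T -> U) (g : U -> R) (C b : R) :
  (forall i, measurable_fun setT (Y i)) -> mutually_independent P Y ->
  measurable_fun setT g ->
  (forall i, \int[P]_w (expR (g (Y i w)))%:E <= C%:E)%E ->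
  measurable [set w | b <= \sum_i g (Y i w)] /\
  (P [set w | (b <= \sum_i g (Y i w))%R] <= (C ^+ n * expR (- b))%:E)%E.
Proof.
move=> mY indY mg hC.
have mS : measurable_fun setT (fun w => \sum_i g (Y i w)).
  by apply: measurable_sum => i; exact: measurableT_comp.
have mB : measurable [set w | b <= \sum_i g (Y i w)].
  rewrite (_ : [set w | _] = (fun w => \sum_i g (Y i w)) @^-1` `[b, +oo[%classic).
    by rewrite -[X in measurable X]setTI; exact: mS.
  by apply/seteqP; split => w /=; rewrite in_itv /= andbT.
split=> //.
have fin i : (\int[P]_w (expR (g (Y i w)))%:E =
              (fine (\int[P]_w (expR (g (Y i w)))%:E))%:E)%E.
  rewrite fineK // ge0_fin_numE.
    by apply: le_lt_trans (hC i) _; exact: ltry.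
  by apply: integral_ge0 => w _; rewrite lee_fin expR_ge0.
have me : measurable_fun setT (fun x => expR (g x)).
  by apply: measurableT_comp => //; exact: measurable_expR.
have key := indep_prod mY indY (fun=> me) (fun _ x => expR_ge0 (g x)) fin.
rewrite -[X in P X]setIT -integral_indic //.
apply: (@le_trans _ _ (\int[P]_w ((expR (- b))%:E * (\prod_i expR (g (Y i w)))%R%:E))%E).
  apply: ge0_le_integral => //.
  - by apply/measurable_EFinP; exact: measurable_indic.
  - apply/measurable_EFinP; apply: measurable_funM => //.
    by apply: measurable_prod => i _; exact: (measurableT_comp me (mY i)).
  - move=> w _; rewrite -EFinM lee_fin -expR_sum -expRD indicE.
    case: (boolP (w \in _)) => [/set_mem /= h|_]; last exact: expR_ge0.
    by rewrite -expR0 ler_expR addrC subr_ge0.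
rewrite ge0_integralZl_EFin //; last 2 first.
- by move=> w _; rewrite lee_fin; apply: prodr_ge0 => i _; exact: expR_ge0.
- apply/measurable_EFinP.
  by apply: measurable_prod => i _; exact: (measurableT_comp me (mY i)).
rewrite key -EFinM lee_fin mulrC ler_wpM2r ?expR_ge0 //.
rewrite -[n in C ^+ n]card_ord -prodr_const; apply: ler_prod => i _.
by rewrite -!lee_fin -fin hC andbT; apply: integral_ge0 => w _; rewrite lee_fin expR_ge0.
Qed.

End Independence.

(** * Sub-Gaussian rows *)

Section Borel.
Variable R : realType.

Lemma borelM_entry m p (i : 'I_m) (j : 'I_p) :
  measurable_fun setT (fun M : borelM R m p => (M : 'M[R]_(m, p)) i j).
Proof.
apply: (measurability _ (RGenOpens.measurableE R)).
move=> _ [_ [a [b ->]] <-]; rewrite setTI.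
apply: sub_sigma_algebra.
by apply: open_comp; [move=> M _; exact: coord_continuous|exact: interval_open].
Qed.

Lemma continuous_row_tr m p (i : 'I_m) :
  continuous (fun M : 'M[R]_(m, p) => (row i M)^T).
Proof.
move=> M A /nbhs_ballP[e /= e0 hA]; apply/nbhs_ballP; exists e => // N [_ h].
by apply: hA; split=> // a b; rewrite !mxE; exact: h.
Qed.

Lemma borelM_row m p (i : 'I_m) :
  measurable_fun setT
    (fun M : borelM R m p => (row i (M : 'M[R]_(m, p)))^T : borelM R p 1).
Proof.
apply: (@measurability _ _ (borelM R m p) (borelM R p 1) setT _ (@open 'M[R]_(p, 1)) erefl).
move=> _ [B oB <-]; rewrite setTI.
apply: sub_sigma_algebra; apply: open_comp oB => M _.
exact: continuous_row_tr.
Qed.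

End Borel.

Section Moments.
Context (R : realType) (n p : nat) (ev : 'rV[R]_p)
  (d0 : measure_display) (T0 : measurableType d0) (P0 : probability T0 R)
  (x : T0 -> 'cV[R]_p)
  (d : measure_display) (T : measurableType d) (P : probability T R)
  (X : T -> 'M[R]_(n, p)) (sigma tau : R).
Hypothesis ev_gt0 : forall i : 'I_p, 0 < ev 0 i.
Hypothesis hx : measurable_fun [set: T0] (x : T0 -> borelM R p 1).
Hypothesis hx_cov : second_moment P0 x (Sigma ev).
Hypothesis hX : measurable_fun [set: T] (X : T -> borelM R n p).
Hypothesis hX_law : forall i : 'I_n,
  same_law P P0 (fun w => (row i (X w))^T : borelM R p 1) (x : T0 -> borelM R p 1).
Hypothesis hZ : forall i : 'I_n,
  (psi2_norm_vec P (fun w => (row i (X w *m Sigma_invsqrt ev))^T) <= sigma%:E)%E.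
Hypothesis st : sigma < tau.

Definition design_row (i : 'I_n) (w : T) : borelM R p 1 := (row i (X w))^T.

Lemma measurable_design_row i : measurable_fun setT (design_row i).
Proof. exact: (measurableT_comp (borelM_row i) hX). Qed.

Lemma measurable_inner (r : 'cV[R]_p) :
  measurable_fun setT (fun y : borelM R p 1 => inner r (y : 'cV[R]_p)).
Proof.
under eq_fun do rewrite innerE.
apply: measurable_sum => j; apply: measurable_funM => //.
exact: borelM_entry.
Qed.

Lemma law_integral i (f : borelM R p 1 -> R) :
  measurable_fun setT f -> (forall y, 0 <= f y) ->
  (\int[P]_w (f (design_row i w))%:E = \int[P0]_w (f (x w))%:E)%E.
Proof.
move=> mf f0.
have mf' : measurable_fun setT (EFin \o f) by apply/measurable_EFinP.
have f0' : {in [set: borelM R p 1], forall y, 0%R <= (EFin \o f) y}%E.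
  by move=> y _; rewrite /= lee_fin.
have e1 := @ge0_integral_pushforward _ _ _ _ R _ (measurable_design_row i) P setT _ measurableT mf' f0'.
have e2 := @ge0_integral_pushforward _ _ _ _ R _ hx P0 setT _ measurableT mf' f0'.
rewrite preimage_setT in e1; rewrite preimage_setT in e2.
transitivity (\int[pushforward P (design_row i)]_y (EFin \o f) y)%E; first by rewrite e1.
transitivity (\int[pushforward P0 (x : T0 -> borelM R p 1)]_y (EFin \o f) y)%E; last first.
  by rewrite e2.
apply: eq_measure_integral => [|mi A mA _]; first exact: measurable_design_row.
exact: (hX_law i mA).
Qed.

(** Integrability of the mixed products x_j x_l comes from
    |x_j x_l| <= x_j^2 + x_l^2, the diagonal second moments being finite. *)
Lemma second_moment_inner (r : 'cV[R]_p) :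
  (\int[P0]_w (inner r (x w) ^+ 2)%:E = (\sum_j ev 0 j * r j 0 ^+ 2)%:E)%E.
Proof.
have mx j : measurable_fun setT (fun w => x w j 0).
  exact: (measurableT_comp (borelM_entry j 0) hx).
have E j l : (\int[P0]_w (x w j 0 * x w l 0)%:E = (Sigma ev j l)%:E)%E.
  have := hx_cov j l; rewrite unlock => <-; apply: eq_integral => w _.
  by rewrite mxE big_ord1 mxE.
have I2 j : P0.-integrable setT (fun w => (x w j 0 * x w j 0)%:E).
  apply/integrableP; split.
    by apply/measurable_EFinP; exact: measurable_funM.
  under eq_integral => w _ do rewrite gee0_abs ?lee_fin -?expr2 ?sqr_ge0 // expr2.
  by rewrite E ltry.
have I j l : P0.-integrable setT (fun w => (x w j 0 * x w l 0)%:E).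
  apply: (@le_integrable _ _ _ _ _ measurableT _
     (fun w => (x w j 0 * x w j 0)%:E + (x w l 0 * x w l 0)%:E)%E).
  - by apply/measurable_EFinP; exact: measurable_funM.
  - move=> w _; rewrite -EFinD !abse_EFin lee_fin [leRHS]ger0_norm; last first.
      by rewrite -!expr2 addr_ge0 ?sqr_ge0.
    rewrite ler_norml; apply/andP; split; nra.
  - by apply: integrableD.
transitivity (\int[P0]_w (\sum_j \sum_l (r j 0 * r l 0)%:E * (x w j 0 * x w l 0)%:E))%E.
  apply: eq_integral => w _; rewrite innerE expr2 mulr_suml -sumEFin.
  apply: eq_bigr => j _; rewrite mulr_sumr -sumEFin; apply: eq_bigr => l _.
  by rewrite -EFinM mulrACA.
rewrite integral_sum //; last first.
  move=> j; apply: integrable_sum => // l _; exact: integrableZl.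
rewrite -sumEFin; apply: eq_bigr => j _.
rewrite integral_sum //; last by move=> l; exact: integrableZl.
under eq_bigr => l _ do rewrite integralZl // E -EFinM.
rewrite sumEFin (bigD1 j) //= big1 => [|l lj]; last first.
  by rewrite !mxE eq_sym (negPf lj) mulr0n mulr0.
by rewrite addr0 !mxE eqxx mulr1n -expr2 mulrC.
Qed.

(** The direction r for X is the unit direction Sigma^(1/2) r for Z. The psi_2 norm is an infimum that need not be attained,
    whence the strict inequality sigma < tau. *)
Lemma expR_unit_direction i (r : 'cV[R]_p) : \sum_j ev 0 j * r j 0 ^+ 2 = 1 ->
  (\int[P]_w (expR (inner r (design_row i w) ^+ 2 / tau ^+ 2))%:E <= 2%:E)%E.
Proof.
move=> r1.
pose s : 'cV[R]_p := \col_j (Num.sqrt (ev 0 j) * r j 0).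
have ss : inner s s = 1.
  rewrite innerE -r1; apply: eq_bigr => j _; rewrite !mxE.
  by rewrite -expr2 exprMn sqr_sqrtr // ltW.
have s0 : s != 0 by rewrite -inner_eq0 ss oner_eq0.
have sE w : inner s (row i (X w *m Sigma_invsqrt ev))^T / norm2 s = inner r (design_row i w).
  rewrite /norm2 ss sqrtr1 divr1 !innerE; apply: eq_bigr => j _.
  rewrite !mxE (bigD1 j) //= big1 => [|l lj]; last first.
    by rewrite !mxE (negPf lj) mulr0n mulr0.
  rewrite addr0 !mxE eqxx mulr1n; field.
  by rewrite gt_eqF // sqrtr_gt0.
have hs := hZ i.
have lt : (psi2_norm P (fun w => inner s (row i (X w *m Sigma_invsqrt ev))^T / norm2 s)%R < tau%:E)%E.
  apply: le_lt_trans (_ : (sigma%:E < _)%E); last by rewrite lte_fin.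
  by apply: le_trans hs; apply: ereal_sup_ubound; exists s.
have [_ [t [t0 ht] <-]] := ereal_inf_lt lt; rewrite lte_fin => tt.
have {}ht : (\int[P]_w (expR (inner r (design_row i w) ^+ 2 / t ^+ 2))%:E <= 2%:E)%E.
  apply: le_trans ht; rewrite unlock; apply: le_of_eq.
  by apply: eq_integral => w _; rewrite -sE.
have mq a : measurable_fun setT (fun w => expR (inner r (design_row i w) ^+ 2 / a ^+ 2)).
  apply: measurableT_comp => //; apply: measurable_funM => //.
  apply: measurable_funX; exact: (measurableT_comp (measurable_inner r) (measurable_design_row i)).
apply: le_trans ht; apply: ge0_le_integral => //.
- exact/measurable_EFinP/mq.
- exact/measurable_EFinP/mq.
- move=> w _; rewrite lee_fin ler_expR ler_wpM2l ?sqr_ge0 //.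
  have tau0 : 0 < tau by apply: lt_trans tt.
  by rewrite lef_pV2 ?posrE ?exprn_gt0 // ler_sqr ?nnegrE ?ltW.
Qed.

Section Mixture.
Variables (I : finType) (c : I -> R) (r : I -> 'cV[R]_p).
Hypothesis c0 : forall a, 0 <= c a.
Hypothesis c1 : \sum_a c a = 1.
Hypothesis r1 : forall a, \sum_j ev 0 j * r a j 0 ^+ 2 = 1.

(** Rows of X have dependent coordinates, so the squared norm of a block of a
    row is handled as a convex combination of squares of unit directions. *)
Definition sq_mixture (y : borelM R p 1) : R := \sum_a c a * inner (r a) (y : 'cV[R]_p) ^+ 2.

Lemma sq_mixture_ge0 y : 0 <= sq_mixture y.
Proof. by apply: sumr_ge0 => a _; rewrite mulr_ge0 ?sqr_ge0. Qed.

Lemma measurable_sq_mixture : measurable_fun setT sq_mixture.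
Proof.
apply: measurable_sum => a; apply: measurable_funM => //.
by apply: measurable_funX; exact: measurable_inner.
Qed.

(** The tangent line of exp at the mean lies below exp. *)
Lemma expR_jensen (z : I -> R) :
  expR (\sum_a c a * z a) <= \sum_a c a * expR (z a).
Proof.
set m := \sum_a c a * z a.
have h a : c a * (expR m * (1 + (z a - m))) <= c a * expR (z a).
  have -> : expR (z a) = expR m * expR (z a - m) by rewrite -expRD addrC subrK.
  by rewrite ler_wpM2l // ler_wpM2l ?expR_ge0 // expR_ge1Dx.
apply: le_trans (ler_sum _ (fun a _ => h a)).
rewrite (eq_bigr (fun a => expR m * (1 - m) * c a + expR m * (c a * z a))); last first.
  by move=> a _; ring.
rewrite big_split /= -!mulr_sumr c1 -/m mulr1.
by apply: le_of_eq; ring.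
Qed.

(** By convexity a mixture has the same exponential moment as one direction. *)
Lemma sq_mixture_exp i :
  (\int[P]_w (expR (sq_mixture (design_row i w) / tau ^+ 2))%:E <= 2%:E)%E.
Proof.
have m1 a : measurable_fun setT (fun w => expR (inner (r a) (design_row i w) ^+ 2 / tau ^+ 2)).
  apply: measurableT_comp => //; apply: measurable_funM => //.
  apply: measurable_funX; exact: (measurableT_comp (measurable_inner (r a)) (measurable_design_row i)).
apply: (@le_trans _ _ (\int[P]_w (\sum_a (c a)%:E * (expR (inner (r a) (design_row i w) ^+ 2 / tau ^+ 2))%:E))%E).
  apply: ge0_le_integral => //.
  - apply/measurable_EFinP; apply: measurableT_comp => //; apply: measurable_funM => //.
    exact: (measurableT_comp measurable_sq_mixture (measurable_design_row i)).
  - apply: emeasurable_sum => a; apply/measurable_EFinP; exact: measurable_funM.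
  - move=> w _; rewrite sumEFin lee_fin /sq_mixture mulr_suml.
    by under eq_bigr do rewrite -mulrA; exact: expR_jensen.
rewrite ge0_integral_sum //; last 2 first.
- by move=> a; apply/measurable_EFinP; exact: measurable_funM.
- by move=> a w _; rewrite lee_fin mulr_ge0 ?expR_ge0.
apply: (@le_trans _ _ (\sum_a (c a)%:E * 2%:E)%E).
  apply: lee_sum => a _; rewrite ge0_integralZl_EFin //; last exact/measurable_EFinP.
  by rewrite lee_wpmul2l ?lee_fin //; exact: expR_unit_direction.
by rewrite sumEFin lee_fin -mulr_suml c1 mul1r.
Qed.

Lemma sq_mixture_mean i : (\int[P]_w (sq_mixture (design_row i w))%:E = 1)%E.
Proof.
rewrite (law_integral i measurable_sq_mixture sq_mixture_ge0).
under eq_integral do rewrite -sumEFin; rewrite ge0_integral_sum //; last 2 first.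
- move=> a; apply/measurable_EFinP; apply: measurable_funM => //.
  by apply: measurable_funX; exact: (measurableT_comp (measurable_inner (r a)) hx).
- by move=> a w _; rewrite lee_fin mulr_ge0 ?sqr_ge0.
rewrite (eq_bigr (fun a => (c a)%:E)); first by rewrite sumEFin c1.
move=> a _; under eq_integral do rewrite EFinM.
rewrite ge0_integralZl_EFin //.
  by rewrite second_moment_inner r1 mule1.
- by move=> w _; rewrite lee_fin sqr_ge0.
- apply/measurable_EFinP.
  by apply: measurable_funX; exact: (measurableT_comp (measurable_inner (r a)) hx).
Qed.

Lemma sqr_half_le_expR (y : R) : 0 <= y -> (1 + y / 2) ^+ 2 <= expR y.
Proof.
move=> y0; have -> : expR y = expR (y / 2) ^+ 2.
  by rewrite expr2 -expRD; congr expR; lra.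
by rewrite ler_sqr ?nnegrE ?expR_ge0 ?expR_ge1Dx //; lra.
Qed.

Lemma expRN_le (y : R) : 0 <= y -> expR (- y) <= 1 - y + y ^+ 2.
Proof.
move=> y0; rewrite expRN -[leLHS]mul1r.
have e0 : 0 < expR y := expR_gt0 y.
rewrite ler_pdivrMr //.
have h := sqr_half_le_expR y0; have q0 : 0 <= 1 - y + y ^+ 2 by nra.
apply: (le_trans _ (ler_wpM2l q0 h)); nra.
Qed.

(** For the lower tail, E exp (- s Y) <= 1 - s E Y + s^2 E Y^2 with E Y = 1, and
    the exponential moment controls Y^2 <= 4 tau^4 exp (Y / tau^2). *)
Lemma sq_mixture_negexp i s : 0 < tau -> 0 <= s ->
  (\int[P]_w (expR (- (s * sq_mixture (design_row i w))))%:E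
     <= (expR (- s + 8 * s ^+ 2 * tau ^+ 4))%:E)%E.
Proof.
move=> tau0 s0.
have mY : measurable_fun setT (fun w => sq_mixture (design_row i w)).
  exact: (measurableT_comp measurable_sq_mixture (measurable_design_row i)).
have m1 : measurable_fun setT (fun w => expR (- (s * sq_mixture (design_row i w)))).
  by apply: measurableT_comp => //; apply: measurableT_comp => //; exact: measurable_funM.
have m2 : measurable_fun setT (fun w => expR (sq_mixture (design_row i w) / tau ^+ 2)).
  by apply: measurableT_comp => //; exact: measurable_funM.
set k := 4 * s ^+ 2 * tau ^+ 4.
have k0 : 0 <= k by rewrite /k !mulr_ge0 ?exprn_ge0 // ltW.
have sE : (s%:E = \int[P]_w (s%:E * (sq_mixture (design_row i w))%:E))%E.
  rewrite ge0_integralZl_EFin //.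
  - by rewrite sq_mixture_mean mule1.
  - by move=> w _; rewrite lee_fin sq_mixture_ge0.
  - exact/measurable_EFinP.
have h : (\int[P]_w (expR (- (s * sq_mixture (design_row i w))))%:E + s%:E <= 1 + k%:E * 2%:E)%E.
  rewrite [X in (_ + X <= _)%E]sE -ge0_integralD //; first last.
  - by apply/measurable_EFinP; exact: measurable_funM.
  - by move=> w _; rewrite -EFinM lee_fin mulr_ge0 // sq_mixture_ge0.
  - exact/measurable_EFinP.
  apply: (@le_trans _ _ (\int[P]_w (1 + k%:E * (expR (sq_mixture (design_row i w) / tau ^+ 2))%:E))%E).
    apply: ge0_le_integral => //.
    - by move=> w _; rewrite -EFinM -EFinD lee_fin addr_ge0 ?expR_ge0 // mulr_ge0 // sq_mixture_ge0.
    - by apply/measurable_EFinP; apply: measurable_funD => //; exact: measurable_funM.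
    - by apply/measurable_EFinP; apply: measurable_funD => //; exact: measurable_funM.
    - move=> w _; rewrite -!EFinM -!EFinD lee_fin.
      have Y0 := sq_mixture_ge0 (design_row i w); set Y := sq_mixture _ in Y0 *.
      have := expRN_le (mulr_ge0 s0 Y0).
      have t2 : 0 < tau ^+ 2 by rewrite exprn_gt0.
      have u0 : 0 <= Y / tau ^+ 2 by rewrite divr_ge0 // ltW.
      have := sqr_half_le_expR u0; set u := Y / _ in u0 *; set eu := expR u => h1 h2.
      have YE : Y = u * tau ^+ 2 by rewrite /u divfK // gt_eqF.
      have h3 : (s * Y) ^+ 2 <= k * eu.
        rewrite (_ : (s * Y) ^+ 2 = k * (u ^+ 2 / 4)); last by rewrite /k YE; field.
        rewrite ler_wpM2l //; apply: le_trans h1; nra.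
      lra.
  rewrite ge0_integralD //; last 2 first.
  - by move=> w _; rewrite -EFinM lee_fin mulr_ge0 ?expR_ge0.
  - by apply/measurable_EFinP; exact: measurable_funM.
  have -> : (\int[P]_w (1 : \bar R) = 1)%E.
    by rewrite integral_cst // mul1e; exact: probability_setT.
  rewrite leeD2l //.
  rewrite ge0_integralZl_EFin //; last exact/measurable_EFinP.
  by rewrite lee_wpmul2l ?lee_fin //; exact: sq_mixture_exp.
have h2 : (\int[P]_w (expR (- (s * sq_mixture (design_row i w))))%:E <= (1 + k * 2 - s)%:E)%E.
  by rewrite EFinB leeBrDr // EFinD EFinM.
apply: le_trans h2 _; rewrite lee_fin; apply: le_trans (expR_ge1Dx _).
rewrite /k; lra.
Qed.

Hypothesis hX_indep : mutually_independent P
       (fun (i : 'I_n) (w : T) => (row i (X w))^T : borelM R p 1).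

(** The exponential Markov inequality at level 2 n gives 2^n e^(-2n), and 2 <= e. *)
Lemma sq_mixture_upper : 0 < tau ->
  with_prob P (1 - expR (- n%:R))
    [set w | \sum_i sq_mixture (design_row i w) <= 2 * tau ^+ 2 * n%:R].
Proof.
move=> tau0; have t2 : 0 < tau ^+ 2 by rewrite exprn_gt0.
have mg : measurable_fun setT (fun y => sq_mixture y / tau ^+ 2).
  by apply: measurable_funM => //; exact: measurable_sq_mixture.
have [mB hB] := indep_expR_markov (2 * n%:R) measurable_design_row hX_indep mg sq_mixture_exp.
exists (~` [set w | 2 * n%:R <= \sum_i sq_mixture (design_row i w) / tau ^+ 2]); split.
- exact: measurableC.
- move=> w /= /negP; rewrite -ltNge -mulr_suml ltr_pdivrMr // => /ltW h.
  by apply: le_trans h _; apply: le_of_eq; ring.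
- rewrite probability_setC // EFinB leeB // (le_trans hB) // lee_fin.
  have e2 : 2 <= expR 1 :> R by have := @expR_ge1Dx R 1; lra.
  rewrite (_ : - n%:R = n%:R * 1 + (- (2 * n%:R))); last by ring.
  rewrite expRD ler_wpM2r ?expR_ge0 // expRM_natl.
  by rewrite lerXn2r ?nnegrE ?expR_ge0.
Qed.

(** The exponent s eta - 8 s^2 tau^4 is maximal at s = eta / (16 tau^4). *)
Lemma sq_mixture_lower eta : 0 < tau -> 0 < eta ->
  with_prob P (1 - expR (- (n%:R * (eta ^+ 2 / (32 * tau ^+ 4)))))
    [set w | (1 - eta) * n%:R <= \sum_i sq_mixture (design_row i w)].
Proof.
move=> tau0 eta0; have t4 : 0 < tau ^+ 4 by rewrite exprn_gt0.
pose s := eta / (16 * tau ^+ 4).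
have s0 : 0 < s by rewrite divr_gt0 // mulr_gt0.
have mg : measurable_fun setT (fun y => - (s * sq_mixture y)).
  apply: measurableT_comp => //.
  by apply: measurable_funM => //; exact: measurable_sq_mixture.
have [mB hB] := indep_expR_markov (- (s * ((1 - eta) * n%:R))) measurable_design_row hX_indep mg
  (fun i => sq_mixture_negexp i tau0 (ltW s0)).
exists (~` [set w | - (s * ((1 - eta) * n%:R)) <= \sum_i - (s * sq_mixture (design_row i w))]); split.
- exact: measurableC.
- move=> w /= /negP; rewrite -ltNge sumrN ltrN2 -mulr_sumr ltr_pM2l //.
  exact: ltW.
- rewrite probability_setC // EFinB leeB // (le_trans hB) // lee_fin.
  rewrite -expRM_natl -expRD ler_expR le_eqVlt; apply/orP; left; apply/eqP.
  by rewrite /s; field; rewrite gt_eqF.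
Qed.

End Mixture.

End Moments.

(** * Combining high-probability events *)

Section WithProb.
Context d (T : measurableType d) (R : realType) (P : probability T R).

Lemma with_prob_sub q (A B : set T) :
  A `<=` B -> with_prob P q A -> with_prob P q B.
Proof. by move=> AB [E [mE EA hE]]; exists E; split=> //; exact: subset_trans AB. Qed.

Lemma with_prob_le q q' (A : set T) : q' <= q -> with_prob P q A -> with_prob P q' A.
Proof.
move=> qq [E [mE EA hE]]; exists E; split=> //.
by apply: le_trans hE; rewrite lee_fin.
Qed.

Lemma with_probI a b (A B : set T) :
  with_prob P (1 - a) A -> with_prob P (1 - b) B -> with_prob P (1 - (a + b)) (A `&` B).
Proof.
move=> [E [mE EA hE]] [F [mF FB hF]]; exists (E `&` F); split.
- exact: measurableI.
- by move=> w [/EA Aw /FB Bw].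
- have cE : (P (~` E) <= a%:E)%E.
    rewrite probability_setC // -[leRHS](_ : 1 - (1 - a)%:E = _)%E ?leeB //.
    by rewrite -EFinB; congr EFin; ring.
  have cF : (P (~` F) <= b%:E)%E.
    rewrite probability_setC // -[leRHS](_ : 1 - (1 - b)%:E = _)%E ?leeB //.
    by rewrite -EFinB; congr EFin; ring.
  rewrite -[E `&` F]setCK setCI probability_setC; last first.
    by apply: measurableU; exact: measurableC.
  rewrite EFinB leeB // EFinD.
  apply: le_trans (leeD cE cF); by apply: measureU2; exact: measurableC.
Qed.

Lemma with_prob_nonempty q (A : set T) : 0 < q -> with_prob P q A -> A !=set0.
Proof.
move=> q0 [E [mE EA hE]]; have [E0|/set0P[w Ew]] := eqVneq E set0.
  by move: hE; rewrite E0 measure0 lee_fin leNgt q0.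
by exists w; exact: EA.
Qed.

Lemma with_prob_bigI (I : finType) (S : pred I) a (A : I -> set T) :
  (forall i, S i -> with_prob P (1 - a) (A i)) ->
  with_prob P (1 - #|S|%:R * a) [set w | forall i, S i -> A i w].
Proof.
move=> hA.
have main (s : seq I) : all S s -> with_prob P (1 - (size s)%:R * a)
    [set w | forall i, i \in s -> A i w].
  elim: s => [_|i s IH /= /andP[Si /IH h]].
    exists setT; split=> //; rewrite mul0r subr0; by rewrite probability_setT.
  have := with_probI (hA i Si) h; rewrite (_ : a + _ = (size s).+1%:R * a); last by rewrite -natr1; ring.
  apply: with_prob_sub => w [A1 A2] j; rewrite inE => /predU1P[->//|]; exact: A2.
have /main : all S (enum S) by apply/allP => i; rewrite mem_enum.
rewrite -cardE; apply: with_prob_sub => w h i Si; apply: h; by rewrite mem_enum.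
Qed.

End WithProb.

(** * A lattice net for singular values *)

Section Net.
Variable R : realType.
Variables (N d : nat).

(** Integer vectors, as a finite type: the boolean is the sign and the ordinal
    the absolute value of a coordinate. The bound N * d holds for each coordinate
    because it holds for the sum of the absolute values (see net_round). *)
Definition net_code := {ffun 'I_d -> bool * 'I_(N * d).+1}.

Definition net_vec (f : net_code) : 'cV[R]_d :=
  \col_j ((-1) ^+ (f j).1 * ((f j).2 : nat)%:R).

Definition net_weight (f : net_code) : nat := \sum_j (f j).2.

Lemma sum_half_powers m : \sum_(a < m) 2^-1 ^+ a <= 2 :> R.
Proof.
suff : \sum_(a < m) 2^-1 ^+ a = 2 - 2 * 2^-1 ^+ m :> R.
  by move=> ->; rewrite gerBl mulr_ge0 // exprn_ge0 // invr_ge0.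
elim: m => [|m IH]; first by rewrite big_ord0 expr0; lra.
by rewrite big_ord_recr /= IH exprS; lra.
Qed.

(** Each net vector is counted with the weight 2^(N d - sum of the absolute
    values) >= 1; the sum of the weights factors over the coordinates into d
    geometric series, each at most 2 for either sign. *)
Lemma card_net : #|[pred f : net_code | (net_weight f <= N * d)%N]|%:R
  <= (2 ^+ N.+2) ^+ d :> R.
Proof.
have h2 : 0 <= 2^-1 :> R by rewrite invr_ge0.
rewrite -sum1_card natr_sum /=.
apply: (@le_trans _ _ (\sum_(f : net_code) 2 ^+ (N * d) * \prod_j 2^-1 ^+ (f j).2)).
  rewrite [leLHS]big_mkcond; apply: ler_sum => f _.
  case: ifP => hf; last by rewrite mulr_ge0 ?exprn_ge0 // prodr_ge0 // => j _; rewrite exprn_ge0.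
  rewrite inE in hf.
  rewrite prodrXr -/(net_weight f) exprVn -(subnK hf) exprD mulfK ?expf_neq0 //.
  by rewrite exprn_ege1 // ler1n.
rewrite -mulr_sumr -(bigA_distr_bigA (fun (j : 'I_d) (c : bool * 'I_(N * d).+1) => 2^-1 ^+ c.2 : R)).
rewrite /= prodr_const card_ord exprM -exprMn.
set S := \sum_j _.
have S0 : 0 <= S by apply: sumr_ge0 => c _; exact: exprn_ge0.
have S4 : S <= 2 ^+ 2.
  rewrite /S -(pair_bigA _ (fun (b : bool) (a : 'I_(N * d).+1) => 2^-1 ^+ a : R)) /=.
  by rewrite big_bool /=; have := sum_half_powers (N * d).+1; lra.
apply: lerXn2r; rewrite ?nnegrE.
- by rewrite mulr_ge0 ?exprn_ge0.
- by rewrite exprn_ge0.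
- have -> : 2 ^+ N.+2 = 2 ^+ N * 2 ^+ 2 :> R by rewrite -exprD addn2.
  by rewrite ler_wpM2l ?exprn_ge0.
Qed.

(** Rounding towards zero a vector of norm N sqrt d moves it by at most sqrt d,
    does not increase its norm, and leaves an l1 norm at most N d. *)
Lemma net_round (x : 'cV[R]_d) : inner x x = N%:R ^+ 2 * d%:R ->
  exists f : net_code, [/\ (net_weight f <= N * d)%N,
    inner (net_vec f) (net_vec f) <= inner x x &
    inner (x - net_vec f) (x - net_vec f) <= d%:R].
Proof.
move=> xx; pose a j := Num.truncn `|x j 0|.
have aI j : (a j)%:R <= `|x j 0| < (a j).+1%:R by rewrite truncn_itv.
have S1 : \sum_j `|x j 0| <= N%:R * d%:R.
  pose u : 'cV[R]_d := \col_j `|x j 0|; pose o : 'cV[R]_d := const_mx 1.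
  have : inner u o ^+ 2 <= (N%:R * d%:R) ^+ 2.
    apply: le_trans (inner_CS u o) _.
    have -> : inner u u = inner x x.
      by rewrite !innerE; apply: eq_bigr => j _; rewrite mxE -normrM ger0_norm // -expr2 sqr_ge0.
    have -> : inner o o = d%:R.
      rewrite innerE (eq_bigr (fun=> 1)); last by move=> j _; rewrite !mxE mulr1.
      by rewrite sumr_const card_ord.
    by rewrite xx exprMn -mulrA -expr2.
  rewrite ler_sqr ?nnegrE ?mulr_ge0 //; last first.
    by rewrite innerE sumr_ge0 // => j _; rewrite !mxE mulr1.
  by rewrite innerE; under eq_bigr do rewrite !mxE mulr1.
have W : (\sum_j a j <= N * d)%N.
  rewrite -(ler_nat R) natrM; apply: le_trans S1; rewrite natr_sum; apply: ler_sum => j _.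
  by have /andP[] := aI j.
have aN j : (a j < (N * d).+1)%N.
  by rewrite ltnS; apply: leq_trans W; rewrite (bigD1 j) //= leq_addr.
exists [ffun j => (x j 0 < 0, Ordinal (aN j))].
have xE j : x j 0 = (-1) ^+ (x j 0 < 0)%R * `|x j 0| by rewrite -numEsign.
have sg (b : bool) (y : R) : ((-1) ^+ b * y) ^+ 2 = y ^+ 2 by rewrite exprMn sqrr_sign mul1r.
split.
- by rewrite /net_weight (eq_bigr a) // => j _; rewrite ffunE.
- rewrite !innerE; apply: ler_sum => j _; rewrite !mxE !ffunE /= -!expr2 sg.
  rewrite -(real_normK (num_real (x j 0))) ler_sqr ?nnegrE //.
  by have /andP[] := aI j.
- rewrite innerE -[d in d%:R]card_ord -sumr_const; apply: ler_sum => j _.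
  rewrite !mxE !ffunE /= -expr2 {1}xE -mulrBr sg.
  have /andP[h1 h2] := aI j; rewrite -natr1 in h2.
  by rewrite expr_le1 // ; lra.
Qed.

Variables (n : nat) (G : 'M[R]_(n, d)) (K : R).
Hypothesis N2 : (2 <= N)%N.
Hypothesis K0 : 0 < K.
Hypothesis NK : 128 * K <= N%:R ^+ 2.
Hypothesis hG : forall f : net_code, (net_weight f <= N * d)%N ->
  n%:R / 2 * inner (net_vec f) (net_vec f) <= inner (G *m net_vec f) (G *m net_vec f)
   <= K * n%:R * inner (net_vec f) (net_vec f).

Lemma inner_sum_le m (u v : 'cV[R]_m) :
  inner (u + v) (u + v) <= 2 * inner u u + 2 * inner v v.
Proof.
have := inner_ge0 (u - v).
rewrite !(innerDl, innerDr, innerNl, innerNr) (innerC v u); lra.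
Qed.

Lemma net_scale (v : 'cV[R]_d) : v != 0 -> exists t, t != 0 /\
  inner (t *: v) (t *: v) = N%:R ^+ 2 * d%:R.
Proof.
move=> v0; have vv := inner_gt0 v0.
have d0 : (0 < d)%N.
  by case: d v v0 vv => // v; rewrite (flatmx0 v) eqxx.
have N0 : 0 < N%:R :> R by rewrite ltr0n (leq_trans _ N2).
exists (Num.sqrt (N%:R ^+ 2 * d%:R / inner v v)); split.
  by rewrite gt_eqF // sqrtr_gt0 divr_gt0 // mulr_gt0 ?exprn_gt0 // ltr0n.
rewrite innerZl innerZr mulrA -expr2 sqr_sqrtr ?divfK ?gt_eqF //.
by rewrite divr_ge0 ?inner_ge0 // mulr_ge0 // exprn_ge0.
Qed.

Lemma gram_qform (v : 'cV[R]_d) : qform (G^T *m G) v = inner (G *m v) (G *m v).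
Proof. by rewrite qformE -mulmxA inner_mulmx trmxK. Qed.

(** Let B be the largest eigenvalue of G^T G. At a maximiser rounded to the net,
    N^2 d B <= 2 |G z|^2 + 2 B d, so the rounding error costs the fraction
    2 / N^2 <= 1/2 of B only. *)
Lemma net_upper (v : 'cV[R]_d) : inner (G *m v) (G *m v) <= 4 * K * n%:R * inner v v.
Proof.
case: (posnP d) => [d0|d0].
  have -> : v = 0.
    by apply/matrixP => i j; have := ltn_ord i; rewrite [X in (_ < X)%N]d0.
  by rewrite mulmx0 /inner !mulmx0 !mxE mulr0.
have sM : (G^T *m G)^T = G^T *m G by rewrite trmx_mul trmxK.
have [u [u0 uE]] := @mu_vec _ _ (G^T *m G) 1 sM d0.
set B := mu _ 1 in uE.
have hB w : inner (G *m w) (G *m w) <= B * inner w w.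
  by rewrite -gram_qform; have /andP[] := qform_mu w sM.
suff BK : B <= 4 * K * n%:R.
  by apply: le_trans (hB v) _; rewrite ler_wpM2r ?inner_ge0.
have [t [t0 tE]] := net_scale u0.
have [f [fw fz fe]] := net_round tE.
set x := t *: u in tE fz fe; set z := net_vec f in fz fe.
have xB : inner (G *m x) (G *m x) = B * inner x x.
  rewrite gram_qform in uE.
  by rewrite /x -scalemxAr !(innerZl, innerZr) uE; ring.
have B0 : 0 <= B.
  by have := inner_ge0 (G *m u); rewrite -gram_qform uE pmulr_lge0 // inner_gt0.
have h1 := inner_sum_le (G *m z) (G *m (x - z)).
rewrite -mulmxDr addrC subrK xB in h1.
have /andP[_ h2] := hG fw; rewrite -/z in h2.
have h3 := hB (x - z).
have h4 : K * n%:R * inner z z <= K * n%:R * inner x x.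
  by rewrite ler_wpM2l // mulr_ge0 // ltW.
have h5 := ler_wpM2l B0 fe.
have d1 : 0 < d%:R :> R by rewrite ltr0n.
have N4 : 4 <= N%:R ^+ 2 :> R.
  by have : 2 <= N%:R :> R; [rewrite ler_nat | nra].
rewrite tE in h1 h4.
have h6 : B * d%:R * 4 <= B * d%:R * N%:R ^+ 2.
  by rewrite ler_wpM2l // mulr_ge0 // ltW.
have Nd : 0 < N%:R ^+ 2 * d%:R :> R by rewrite mulr_gt0 // (lt_le_trans _ N4).
rewrite -(ler_pM2r Nd); lra.
Qed.

(** The rounding error is estimated by net_upper; it is of relative size K / N^2,
    which the choice of N makes small against the lower bound on the net. *)
Lemma net_lower (v : 'cV[R]_d) : n%:R / 32 * inner v v <= inner (G *m v) (G *m v).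
Proof.
have [->|v0] := eqVneq v 0; first by rewrite mulmx0 /inner !mulmx0 !mxE mulr0.
have [t [t0 tE]] := net_scale v0.
have [f [fw fz fe]] := net_round tE.
set x := t *: v in tE fz fe; set z := net_vec f in fz fe.
have tt : 0 < t ^+ 2 by rewrite lt_neqAle eq_sym sqrf_eq0 t0 sqr_ge0.
suff h : n%:R / 32 * inner x x <= inner (G *m x) (G *m x).
  rewrite -(ler_pM2l tt); move: h.
  by rewrite /x -scalemxAr !(innerZl, innerZr); lra.
have /andP[h1 _] := hG fw; rewrite -/z in h1.
have h2 := inner_sum_le (G *m x) (G *m (z - x)).
rewrite -mulmxDr addrC subrK in h2.
have h3 := net_upper (z - x).
have zx : inner (z - x) (z - x) <= d%:R.
  by rewrite -(opprB x z) innerNl innerNr opprK.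
have h4 := inner_sum_le z (x - z); rewrite addrC subrK tE in h4.
have n0 : 0 <= n%:R :> R by [].
have N4 : 4 <= N%:R ^+ 2 :> R.
  by have : 2 <= N%:R :> R; [rewrite ler_nat | nra].
have d0 : 0 <= d%:R :> R by [].
have Kn : 0 <= 4 * K * n%:R by rewrite !mulr_ge0 // ltW.
have h5 := ler_wpM2l Kn zx.
have h6 : d%:R * 4 <= d%:R * N%:R ^+ 2 :> R by rewrite ler_wpM2l.
have h7 : N%:R ^+ 2 * d%:R / 4 <= inner z z by lra.
have h8 := ler_wpM2l n0 h7.
have h9 : n%:R * d%:R * (128 * K) <= n%:R * d%:R * N%:R ^+ 2.
  by rewrite ler_wpM2l // mulr_ge0.
rewrite tE; lra.
Qed.

End Net.

(** * Concentration of squared norms of X r *)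

Section Quad.
Context (R : realType) (n p : nat) (ev : 'rV[R]_p)
  (d0 : measure_display) (T0 : measurableType d0) (P0 : probability T0 R)
  (x : T0 -> 'cV[R]_p)
  (d : measure_display) (T : measurableType d) (P : probability T R)
  (X : T -> 'M[R]_(n, p)) (sigma tau : R).
Hypothesis p0 : (0 < p)%N.
Hypothesis ev_gt0 : forall i : 'I_p, 0 < ev 0 i.
Hypothesis hx : measurable_fun [set: T0] (x : T0 -> borelM R p 1).
Hypothesis hx_cov : second_moment P0 x (Sigma ev).
Hypothesis hX : measurable_fun [set: T] (X : T -> borelM R n p).
Hypothesis hX_indep : mutually_independent P
       (fun (i : 'I_n) (w : T) => (row i (X w))^T : borelM R p 1).
Hypothesis hX_law : forall i : 'I_n,
  same_law P P0 (fun w => (row i (X w))^T : borelM R p 1) (x : T0 -> borelM R p 1).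
Hypothesis hZ : forall i : 'I_n,
  (psi2_norm_vec P (fun w => (row i (X w *m Sigma_invsqrt ev))^T) <= sigma%:E)%E.
Hypothesis st : sigma < tau.
Hypothesis tau0 : 0 < tau.

(** The squared norm in the metric of Sigma: X r has mean squared norm
    n * evnorm r. *)
Definition evnorm (r : 'cV[R]_p) : R := \sum_j ev 0 j * r j 0 ^+ 2.

Lemma evnorm_ge0 r : 0 <= evnorm r.
Proof. by apply: sumr_ge0 => j _; rewrite mulr_ge0 ?sqr_ge0 // ltW. Qed.

Lemma evnorm_eq0 r : evnorm r = 0 -> r = 0.
Proof.
move/eqP; rewrite psumr_eq0 => [/allP h|j _]; last by rewrite mulr_ge0 ?sqr_ge0 // ltW.
apply/matrixP => i j; rewrite ord1 mxE; have := h i (mem_index_enum _).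
by rewrite /= mulf_eq0 gt_eqF //= sqrf_eq0 => /eqP.
Qed.

Lemma evnormZ a r : evnorm (a *: r) = a ^+ 2 * evnorm r.
Proof.
rewrite /evnorm mulr_sumr; apply: eq_bigr => j _.
by rewrite !mxE exprMn mulrCA.
Qed.

(** Every direction is a multiple of a unit one; for r = 0 the unit vector is
    arbitrary, and exists because p > 0. *)
Lemma evnorm_unit r : exists u a, [/\ evnorm u = 1, r = a *: u & a ^+ 2 = evnorm r].
Proof.
have [r0|r0] := eqVneq (evnorm r) 0.
  exists ((Num.sqrt (ev 0 (Ordinal p0)))^-1 *: delta_mx (Ordinal p0) 0), 0.
  split; [|by rewrite scale0r; exact: evnorm_eq0|by rewrite r0 expr0n].
  rewrite evnormZ exprVn sqr_sqrtr ?ltW // /evnorm (bigD1 (Ordinal p0)) //= big1 => [|j jp].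
    by rewrite mxE !eqxx expr1n mulr1 addr0 mulVf // gt_eqF.
  by rewrite mxE (negPf jp) expr0n mulr0.
have rp : 0 < evnorm r by rewrite lt_neqAle eq_sym r0 evnorm_ge0.
have s0 : Num.sqrt (evnorm r) != 0 by rewrite gt_eqF // sqrtr_gt0.
exists ((Num.sqrt (evnorm r))^-1 *: r), (Num.sqrt (evnorm r)); split.
- by rewrite evnormZ exprVn sqr_sqrtr ?ltW // mulVf.
- by rewrite scalerA mulfV // scale1r.
- by rewrite sqr_sqrtr // ltW.
Qed.

Lemma sum_sq_mixture (I : finType) (c : I -> R) (r : I -> 'cV[R]_p) w :
  \sum_i sq_mixture c r (design_row X i w) =
  \sum_a c a * inner (X w *m r a) (X w *m r a).
Proof.
rewrite /sq_mixture exchange_big; apply: eq_bigr => a _; rewrite -mulr_sumr; congr (_ * _).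
rewrite innerE; apply: eq_bigr => i _; rewrite expr2; congr (_ * _);
  by rewrite innerE mxE; apply: eq_bigr => j _; rewrite !mxE mulrC.
Qed.

Section Family.
Variables (I : finType) (r : I -> 'cV[R]_p).
Let W := \sum_a evnorm (r a).

Lemma family_mixture : 0 < W -> exists (c : I -> R) (u : I -> 'cV[R]_p),
  [/\ forall a, 0 <= c a, \sum_a c a = 1, forall a, evnorm (u a) = 1 &
  forall M : 'M[R]_(n, p), \sum_a inner (M *m r a) (M *m r a) =
    W * \sum_a c a * inner (M *m u a) (M *m u a)].
Proof.
move=> W0.
have /choice[ua hu] a := evnorm_unit (r a).
have /choice[al hal] a := hu a.
exists (fun a => evnorm (r a) / W), ua; split.
- by move=> a; rewrite divr_ge0 ?evnorm_ge0 // ltW.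
- by rewrite -mulr_suml mulfV // gt_eqF.
- by move=> a; have [] := hal a.
- move=> M; rewrite mulr_sumr; apply: eq_bigr => a _.
  have [_ -> <-] := hal a; rewrite -scalemxAr innerZl innerZr.
  by field; rewrite gt_eqF.
Qed.

Lemma family_trivial : ~ 0 < W -> forall a, r a = 0.
Proof.
move=> /negP; rewrite -leNgt => W0 a; apply: evnorm_eq0; apply/eqP.
rewrite eq_le evnorm_ge0 andbT; apply: le_trans W0.
by rewrite /W (bigD1 a) //= lerDl sumr_ge0 // => b _; exact: evnorm_ge0.
Qed.

Lemma with_prob_triv q (S : set T) : q <= 1 -> (forall w, S w) -> with_prob P q S.
Proof. by move=> q1 hS; exists setT; split=> //; rewrite probability_setT lee_fin. Qed.

(** All the concentration facts about the design are instances of this lemma and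
    of the next: a single direction is a family over unit, a sum of squared
    column norms is a family over the columns. *)
Lemma quad_upper : with_prob P (1 - expR (- n%:R))
  [set w | \sum_a inner (X w *m r a) (X w *m r a) <= 2 * tau ^+ 2 * n%:R * W].
Proof.
have [W0|W0] := pselect (0 < W).
  have [c [u [c0 c1 u1 hM]]] := family_mixture W0.
  apply: with_prob_sub (sq_mixture_upper ev_gt0 hX hZ st c0 c1 u1 hX_indep tau0) => w /=.
  by rewrite sum_sq_mixture hM => h; rewrite [leRHS]mulrC ler_pM2l.
apply: with_prob_triv => [|w]; first by rewrite gerBl expR_ge0.
have r0 := family_trivial W0.
rewrite /= big1 => [|a _]; last by rewrite r0 mulmx0 /inner mulmx0 mxE.
apply: mulr_ge0; first by rewrite !mulr_ge0 // ltW.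
by apply: sumr_ge0 => a _; exact: evnorm_ge0.
Qed.

Lemma quad_lower eta : 0 < eta ->
  with_prob P (1 - expR (- (n%:R * (eta ^+ 2 / (32 * tau ^+ 4)))))
  [set w | (1 - eta) * n%:R * W <= \sum_a inner (X w *m r a) (X w *m r a)].
Proof.
move=> eta0; have [W0|W0] := pselect (0 < W).
  have [c [u [c0 c1 u1 hM]]] := family_mixture W0.
  apply: with_prob_sub (sq_mixture_lower ev_gt0 hx hx_cov hX hX_law hZ st c0 c1 u1 hX_indep tau0 eta0) => w /=.
  by rewrite sum_sq_mixture hM => h; rewrite [leLHS]mulrC ler_pM2l.
apply: with_prob_triv => [|w]; first by rewrite gerBl expR_ge0.
have r0 := family_trivial W0.
rewrite /= big1 => [|a _]; last by rewrite r0 mulmx0 /inner mulmx0 mxE.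
rewrite /W big1 ?mulr0 // => a _; rewrite r0 /evnorm big1 // => j _.
by rewrite mxE expr0n mulr0.
Qed.

End Family.

Section HeadIsometry.
Variables (k N : nat).
Let K := 2 * tau ^+ 2.
Hypothesis N2 : (2 <= N)%N.
Hypothesis NK : 128 * K <= N%:R ^+ 2.

(** The right inverse of Sigma^(1/2) on the head block, as a map into R^p; the
    matrix X * whiten is the head block of Z. *)
Definition whiten : 'M[R]_(p, minn k p) :=
  \matrix_(l, j) ((l == head_ord j)%:R / Num.sqrt (ev 0 l)).

Lemma whiten_head (v : 'cV[R]_(minn k p)) j :
  (whiten *m v) (head_ord j) 0 = v j 0 / Num.sqrt (ev 0 (head_ord j)).
Proof.
rewrite mxE (bigD1 j) //= big1 => [|l lj]; last first.
  rewrite mxE (_ : _ == _ = false) ?mul0r //.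
  by apply/negP => /eqP/(congr1 val)/= /val_inj jl; rewrite jl eqxx in lj.
by rewrite mxE eqxx addr0 mul1r mulrC.
Qed.

Lemma whiten_tail (v : 'cV[R]_(minn k p)) (l : 'I_p) : (k <= l)%N ->
  (whiten *m v) l 0 = 0.
Proof.
move=> kl; rewrite mxE big1 // => j _; rewrite mxE (_ : _ == _ = false) ?mul0r //.
apply/negP => /eqP/(congr1 val)/= lj.
by have := leq_trans (ltn_ord j) (geq_minl k p); rewrite -lj ltnNge kl.
Qed.

Lemma evnorm_whiten v : evnorm (whiten *m v) = inner v v.
Proof.
rewrite /evnorm (bigID (fun l : 'I_p => (l < k)%N)) /= [X in _ + X]big1 => [|l]; last first.
  by rewrite -leqNgt => kl; rewrite whiten_tail // expr0n mulr0.
rewrite addr0 -(sum_head_ord k (fun l => ev 0 l * (whiten *m v) l 0 ^+ 2)) innerE.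
apply: eq_bigr => j _; rewrite whiten_head exprMn exprVn sqr_sqrtr ?ltW //.
by field; rewrite gt_eqF.
Qed.

Lemma whiten_surj (r : 'cV[R]_p) : (forall l : 'I_p, (k <= l)%N -> r l 0 = 0) ->
  exists v, r = whiten *m v.
Proof.
move=> hr; exists (\col_j (Num.sqrt (ev 0 (head_ord j)) * r (head_ord j) 0)).
apply/matrixP => l z; rewrite ord1 {z}; case: (ltnP l k) => lk; last first.
  by rewrite whiten_tail // hr.
have lt : (l < minn k p)%N by rewrite leq_min lk ltn_ord.
have -> : l = head_ord (Ordinal lt) by exact: val_inj.
rewrite whiten_head mxE; field.
by rewrite gt_eqF // sqrtr_gt0.
Qed.

(** Union bound over the net of the head block, followed by the deterministic
    passage from the net to all vectors. *)
Lemma head_isometry :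
  with_prob P (1 - (2 ^+ N.+2) ^+ (minn k p) *
     (expR (- n%:R) + expR (- (n%:R / (128 * tau ^+ 4)))))
  [set w | forall r : 'cV[R]_p, (forall l : 'I_p, (k <= l)%N -> r l 0 = 0) ->
     n%:R / 32 * evnorm r <= inner (X w *m r) (X w *m r) <= 4 * K * n%:R * evnorm r].
Proof.
set e := expR (- n%:R) + _.
have e0 : 0 <= e by rewrite addr_ge0 ?expR_ge0.
have K0 : 0 < K by rewrite mulr_gt0 // exprn_gt0.
have h (f : net_code N (minn k p)) : (net_weight f <= N * minn k p)%N ->
  with_prob P (1 - e) [set w | n%:R / 2 * inner (net_vec R f) (net_vec R f)
     <= inner (X w *m whiten *m net_vec R f) (X w *m whiten *m net_vec R f)
     <= K * n%:R * inner (net_vec R f) (net_vec R f)].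
  move=> _; pose r (_ : unit) := whiten *m net_vec R f.
  have half0 : 0 < 2^-1 :> R by rewrite invr_gt0.
  have := with_probI (quad_upper r) (quad_lower r half0).
  have big_unit (F : unit -> R) : \sum_a F a = F tt by rewrite (big_pred1 tt) //; case.
  rewrite (_ : _ / (32 * _) = (128 * tau ^+ 4)^-1); last by field; rewrite gt_eqF.
  apply: with_prob_sub => w /= []; rewrite !big_unit /r evnorm_whiten !mulmxA => h1 h2.
  by rewrite h1 andbT (_ : _ / 2 = (1 - 2^-1) * n%:R) //; field.
have := with_prob_bigI h.
move=> H; apply: with_prob_le (with_prob_sub _ H).
  by rewrite lerD2l lerN2 ler_wpM2r // card_net.
move=> w /= hw r /whiten_surj[v ->].
rewrite evnorm_whiten mulmxA; apply/andP; split.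
  exact: net_lower N2 K0 NK hw _.
exact: net_upper N2 K0 hw _.
Qed.

End HeadIsometry.

End Quad.

(** * Bias and variance from the spectrum of A_k *)

Section Risk.
Variables (R : realType) (n p : nat) (X : 'M[R]_(n, p)) (lam : R) (ev : 'rV[R]_p).
Variables (k : nat) (S al be om ka rr g lk : R).
Hypothesis n0 : (0 < n)%N.
Hypothesis ev_gt0 : forall j, 0 < ev 0 j.
Hypothesis S0 : 0 < S.
Hypothesis al0 : 0 < al.
Hypothesis be0 : 0 < be.
Hypothesis om0 : 0 < om.
Hypothesis ka0 : 0 <= ka.
Hypothesis g0 : 0 <= g.
Hypothesis hAk : forall v : 'cV[R]_n,
  S / al * inner v v <= qform (Amx_tail lam X k) v <= be * S * inner v v.
Hypothesis hX : forall r : 'cV[R]_p, (forall j : 'I_p, (k <= j)%N -> r j 0 = 0) ->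
  om * n%:R * evnorm ev r <= inner (X *m r) (X *m r).
Hypothesis hlam : - lam <= g * S.
Hypothesis hlk : forall j : 'I_p, (k <= j)%N -> ev 0 j <= lk.
Hypothesis hrho : n%:R * lk <= rr * S.
Hypothesis rr0 : 0 <= rr.

Let A := Amx lam X.
Let Ak := Amx_tail lam X k.
Let nR : 0 < n%:R :> R. Proof. by rewrite ltr0n. Qed.
Let m0_gt0 : 0 < S / al. Proof. by rewrite divr_gt0. Qed.
Let w_gt0 : 0 < om * n%:R. Proof. by rewrite mulr_gt0. Qed.
Let m01 : S / al <= be * S.
Proof.
have /andP[a b] := hAk (const_mx 1).
have := le_trans a b; rewrite ler_pM2r // inner_gt0 //.
by apply/eqP => /matrixP/(_ (Ordinal n0) 0); rewrite !mxE; apply/eqP; rewrite oner_eq0.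
Qed.

Lemma Amx_unitmx_tail : A \in unitmx.
Proof. exact: Amx_unitmx m0_gt0 hAk. Qed.

Section Bias.
Variable theta : 'cV[R]_p.
Let Th := \sum_(j < p | (k <= j)%N) ev 0 j * theta j 0 ^+ 2.
Let Tt := \sum_(j < p | (j < k)%N) theta j 0 ^+ 2 / ev 0 j.
Hypothesis hH : inner (X *m tailv k theta) (X *m tailv k theta) <= ka * n%:R * Th.

Definition bias_cst : R :=
  16 * be ^+ 2 / om ^+ 2 + 16 * (1 + g * al) * rr * be / om +
  4 * (al * be + 1) * ka / om + 2 + 6 * (1 + g * al) * al * ka * rr.

(** The head part of the error is Q of ridge_energy_bounds. The tail part is at
    most 2 Th plus 2 lk |X_tail^T u|^2, and |X_tail^T u|^2 = a - lam |u|^2 is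
    comparable with the energy a of u because a negative lam is at most a multiple
    of S; finally lk is at most a multiple of S / n. *)
Lemma bias_sum_le :
  qform (Sigma ev) ((1%:M - X^T *m invmx A *m X) *m theta)
   <= bias_cst * (Th + Tt * (S / n%:R) ^+ 2).
Proof.
pose u := invmx A *m (X *m theta).
have hu : A *m u = X *m theta by rewrite /u mulKVmx // Amx_unitmx_tail.
pose r := theta - X^T *m u.
have -> : (1%:M - X^T *m invmx A *m X) *m theta = r.
  by rewrite mulmxBl mul1mx /r /u !mulmxA.
have [hQ ha] := ridge_energy_bounds ev_gt0 m0_gt0 m01 w_gt0 hAk hX hu.
rewrite -/r -/Tt in hQ; rewrite -/Tt in ha; set Q := \sum_(_ < p | _) _ in hQ.
have hH' := hH; set H := inner _ _ in hH' hQ ha; set a := qform _ _ in ha.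
have qE : qform (Sigma ev) r = Q + \sum_(j < p | (k <= j)%N) ev 0 j * r j 0 ^+ 2.
  rewrite qformE innerE (bigID (fun j : 'I_p => (j < k)%N)) /=; congr (_ + _).
    by apply: eq_bigr => j _; rewrite mul_diag_mx [X in _ * X]mxE; ring.
  by apply: eq_big => [j|j _]; [rewrite -leqNgt|rewrite mul_diag_mx [X in _ * X]mxE; ring].
have Th0 : 0 <= Th by apply: sumr_ge0 => j _; rewrite mulr_ge0 ?sqr_ge0 // ltW.
have T0 : 0 <= Tt by apply: sumr_ge0 => j _; rewrite divr_ge0 ?sqr_ge0 // ltW.
have a0 : 0 <= a by have := qform_Amx_tail_ge0 m0_gt0 hAk u.
have ub : inner u u <= al / S * a.
  have /andP[h _] := hAk u; rewrite -/a in h.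
  by rewrite -(ler_pM2l m0_gt0) (le_trans h) // mulrA mulf_div (mulrC al) divff ?mul1r // mulf_neq0 // gt_eqF.
have lk0 : 0 <= lk \/ forall j : 'I_p, (k <= j)%N -> False.
  have [[j kj]|h] := pselect (exists j : 'I_p, (k <= j)%N).
    by left; apply: le_trans (hlk kj); rewrite ltW.
  by right => j kj; apply: h; exists j.
have tail : \sum_(j < p | (k <= j)%N) ev 0 j * r j 0 ^+ 2
   <= 2 * Th + 2 * ((1 + g * al) * (rr * S / n%:R * a)).
  case: lk0 => [lk0|no]; last first.
    rewrite big1 => [|j /no //]; rewrite addr_ge0 ?mulr_ge0 // ?invr_ge0 ?addr_ge0 ?mulr_ge0 // ltW //.
  apply: (@le_trans _ _ (2 * Th + 2 * (lk * \sum_(j < p | (k <= j)%N) ((X^T *m u) j 0) ^+ 2))).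
    rewrite /Th !mulr_sumr -big_split /=; apply: ler_sum => j kj.
    have -> : r j 0 = theta j 0 - (X^T *m u) j 0 by rewrite !mxE.
    set t := theta j 0; set y := (X^T *m u) j 0.
    have h1 : (t - y) ^+ 2 <= 2 * t ^+ 2 + 2 * y ^+ 2.
      by have := sqr_ge0 (t + y); rewrite sqrrB sqrrD; lra.
    have h2 := ler_wpM2l (ltW (ev_gt0 j)) h1.
    have h3 := ler_wpM2r (sqr_ge0 y) (hlk kj).
    lra.
  rewrite lerD2l ler_pM2l //.
  have sE : \sum_(j < p | (k <= j)%N) ((X^T *m u) j 0) ^+ 2 = a - lam * inner u u.
    by rewrite /a qform_Amx_tail addrAC subrr add0r.
  have h1 : \sum_(j < p | (k <= j)%N) ((X^T *m u) j 0) ^+ 2 <= (1 + g * al) * a.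
    rewrite sE; have h2 := ler_wpM2r (inner_ge0 u) hlam.
    have h3 := ler_wpM2l (mulr_ge0 g0 (ltW S0)) ub.
    have : g * S * (al / S * a) = g * al * a by field; rewrite gt_eqF.
    lra.
  have h2 : lk <= rr * S / n%:R by rewrite ler_pdivlMr // mulrC.
  apply: (le_trans (ler_wpM2l lk0 h1)).
  have h3 := ler_wpM2r a0 h2.
  have ga : 0 <= 1 + g * al by rewrite addr_ge0 // mulr_ge0 // ltW.
  have h4 := ler_wpM2l ga h3.
  lra.
pose q := S / n%:R; pose x := Tt * q ^+ 2.
have x0 : 0 <= x by rewrite mulr_ge0 ?sqr_ge0.
have nn : n%:R != 0 :> R by rewrite gt_eqF.
have Sn : S != 0 by rewrite gt_eqF.
have aln : al != 0 by rewrite gt_eqF.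
have omn : om != 0 by rewrite gt_eqF.
have hQ' : Q <= 16 * be ^+ 2 / om ^+ 2 * x + 4 * (al * be + 1) * ka / om * Th.
  apply: (le_trans hQ); apply: lerD.
    apply: le_of_eq; rewrite /x /q; field.
    by rewrite ?nn ?omn.
  have c0 : 0 <= 4 * (al * be + 1) / (om * n%:R).
    by rewrite divr_ge0 ?mulr_ge0 ?addr_ge0 // ?mulr_ge0 // ltW.
  have h := ler_wpM2l c0 hH'.
  rewrite (_ : 4 * _ * H / _ = 4 * (al * be + 1) / (om * n%:R) * H); last first.
    by field; rewrite ?nn ?omn ?Sn ?aln.
  apply: (le_trans h); apply: le_of_eq; field.
  by rewrite ?nn ?omn.
have ha' : rr * q * a <= 8 * rr * be / om * x + 3 * al * ka * rr * Th.
  have q0 : 0 <= rr * q by rewrite mulr_ge0 // divr_ge0 // ltW.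
  apply: (le_trans (ler_wpM2l q0 ha)); rewrite mulrDr; apply: lerD.
    apply: le_of_eq; rewrite /x /q; field.
    by rewrite ?nn ?omn.
  have c0 : 0 <= 3 * rr * al / n%:R by rewrite divr_ge0 ?mulr_ge0 // ltW.
  have h := ler_wpM2l c0 hH'.
  rewrite (_ : rr * q * _ = 3 * rr * al / n%:R * H); last first.
    by rewrite /q; field; rewrite ?nn ?omn ?Sn ?aln.
  apply: (le_trans h); apply: le_of_eq; field.
  by rewrite ?nn ?omn.
have ga : 0 <= 1 + g * al by rewrite addr_ge0 // mulr_ge0 // ltW.
have h5 := ler_wpM2l ga ha'.
rewrite qE -/q -/x /bias_cst.
have c1 : 0 <= 16 * be ^+ 2 / om ^+ 2 by rewrite divr_ge0 ?mulr_ge0 ?exprn_ge0 // ltW.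
have c2 : 0 <= (1 + g * al) * (8 * rr * be / om).
  by rewrite mulr_ge0 // divr_ge0 ?mulr_ge0 // ltW.
have c3 : 0 <= 4 * (al * be + 1) * ka / om.
  by rewrite divr_ge0 ?mulr_ge0 ?addr_ge0 // ?mulr_ge0 // ltW.
have c4 : 0 <= (1 + g * al) * (3 * al * ka * rr) by rewrite !mulr_ge0 // ltW.
rewrite (_ : 16 * (1 + _) * _ * _ / _ = 2 * ((1 + g * al) * (8 * rr * be / om))); last by field.
rewrite (_ : 6 * _ * _ * _ * _ = 2 * ((1 + g * al) * (3 * al * ka * rr))); last by ring.
have h6 : (1 + g * al) * (rr * S / n%:R * a) <=
   (1 + g * al) * (8 * rr * be / om) * x + (1 + g * al) * (3 * al * ka * rr) * Th.
  by move: h5; rewrite mulrDr /q; lra.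
move: c1 c2 c3 c4 hQ' h6 tail.
set C1 := 16 * _ / _; set C2 := (1 + g * al) * (8 * _ * _ / _); set C3 := 4 * _ * _ / _.
set C4 := (1 + g * al) * (3 * _ * _ * _); set Y := (1 + g * al) * (_ * a).
move=> c1 c2 c3 c4 hQ' h6 tail.
have := mulr_ge0 c1 Th0; have := mulr_ge0 c2 Th0; have := mulr_ge0 c3 x0; have := mulr_ge0 c4 x0.
lra.
Qed.

End Bias.

Section Variance.
Let W2 := \sum_(j < p | (k <= j)%N) ev 0 j ^+ 2.
Hypothesis hV : \sum_(j < p | (k <= j)%N) ev 0 j *
    inner (X *m delta_mx j 0) (X *m delta_mx j (0 : 'I_1)) <= ka * n%:R * W2.

Definition var_cst : R := 8 * al * be / om + ka * al ^+ 2.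

Lemma trace_diag_form m (B : 'M[R]_(m, p)) :
  \tr (B *m Sigma ev *m B^T) =
  \sum_j ev 0 j * inner (B *m delta_mx j 0) (B *m delta_mx j (0 : 'I_1)).
Proof.
rewrite /mxtrace (eq_bigr (fun i => \sum_j ev 0 j * B i j ^+ 2)); last first.
  move=> i _; rewrite mxE; apply: eq_bigr => j _.
  by rewrite mul_mx_diag !mxE; ring.
rewrite exchange_big; apply: eq_bigr => j _; rewrite -mulr_sumr; congr (_ * _).
rewrite innerE; apply: eq_bigr => i _.
by rewrite -colE mxE expr2.
Qed.

(** The trace is the sum over j of lambda_j |A^-1 X_j|^2. For a head index this
    is the dual vector u of ridge_energy_bounds for theta = e_j, which has no tail
    part; for a tail index the crude bound |A^-1 X_j| <= |X_j| / mu_n is enough. *)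
Lemma var_sum_le :
  \tr (invmx A *m X *m Sigma ev *m X^T *m invmx A) <=
   var_cst * (k%:R / n%:R + n%:R * W2 / S ^+ 2).
Proof.
have Au := Amx_unitmx_tail.
have sA : (invmx A)^T = invmx A by rewrite trmx_inv Amx_sym.
have -> : invmx A *m X *m Sigma ev *m X^T *m invmx A =
          (invmx A *m X) *m Sigma ev *m (invmx A *m X)^T.
  by rewrite trmx_mul sA !mulmxA.
rewrite trace_diag_form (bigID (fun j : 'I_p => (j < k)%N)) /=.
have nn : n%:R != 0 :> R by rewrite gt_eqF.
have Sn : S != 0 by rewrite gt_eqF.
have aln : al != 0 by rewrite gt_eqF.
have omn : om != 0 by rewrite gt_eqF.
have uE j : A *m (invmx A *m X *m delta_mx j (0 : 'I_1)) = X *m delta_mx j 0.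
  by rewrite -mulmxA mulKVmx.
have head : \sum_(j < p | (j < k)%N) ev 0 j * inner (invmx A *m X *m delta_mx j 0)
     (invmx A *m X *m delta_mx j (0 : 'I_1)) <= 8 * al * be / om * (k%:R / n%:R).
  apply: (@le_trans _ _ (\sum_(j < p | (j < k)%N) 8 * al * be / (om * n%:R))).
    apply: ler_sum => j jk.
    have [_ ha] := ridge_energy_bounds ev_gt0 m0_gt0 m01 w_gt0 hAk hX (uE j).
    set u := invmx A *m X *m _ in ha *.
    have t0 : tailv k (delta_mx j 0 : 'cV[R]_p) = 0.
      apply/matrixP => i z; rewrite (ord1 z) !mxE; case: ifP => // ki.
      rewrite (_ : i == j = false) //; apply/negP => /eqP ij.
      by move: ki; rewrite ij leqNgt jk.
    rewrite t0 mulmx0 /inner mulmx0 mxE mulr0 mul0r addr0 in ha.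
    rewrite (bigD1 j) //= big1 in ha; last first.
      by move=> i /andP[_ ij]; rewrite mxE (negPf ij) expr0n mul0r.
    rewrite mxE !eqxx expr1n addr0 in ha.
    have /andP[h _] := hAk u.
    have h2 := ler_wpM2l (ltW (ev_gt0 j)) (le_trans h ha).
    have c0 : 0 <= al / S by rewrite divr_ge0 // ltW.
    have h3 := ler_wpM2l c0 h2.
    have evn : ev 0 j != 0 by rewrite gt_eqF.
    rewrite (_ : ev 0 j * inner u u = al / S * (ev 0 j * (S / al * inner u u))); last first.
      by field; rewrite ?Sn ?aln.
    apply: (le_trans h3); apply: le_of_eq; field.
    by rewrite ?nn ?omn ?Sn ?evn.
  rewrite -(sum_head_ord k (fun=> 8 * al * be / (om * n%:R))) sumr_const card_ord.
  rewrite -[leLHS]mulr_natr (_ : _ * (k%:R / n%:R) = 8 * al * be / (om * n%:R) * k%:R); last first.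
    by field; rewrite ?nn ?omn.
  rewrite ler_wpM2l ?ler_nat ?geq_minl //.
  by rewrite divr_ge0 ?mulr_ge0 // ltW.
have tail : \sum_(j < p | ~~ (j < k)%N) ev 0 j * inner (invmx A *m X *m delta_mx j 0)
     (invmx A *m X *m delta_mx j (0 : 'I_1)) <= ka * al ^+ 2 * (n%:R * W2 / S ^+ 2).
  apply: (@le_trans _ _ ((al / S) ^+ 2 * \sum_(j < p | (k <= j)%N) ev 0 j *
    inner (X *m delta_mx j 0) (X *m delta_mx j (0 : 'I_1)))).
    rewrite mulr_sumr (eq_bigl (fun j : 'I_p => (k <= j)%N)); last by move=> j; rewrite -leqNgt.
    apply: ler_sum => j _.
    have h := Amx_inverse_bound m0_gt0 hAk (uE j).
    have c0 : 0 <= (al / S) ^+ 2 * ev 0 j by rewrite mulr_ge0 ?sqr_ge0 // ltW.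
    have := ler_wpM2l c0 h; rewrite -!mulrA; apply: le_trans.
    apply: le_of_eq; field.
    by rewrite ?Sn ?aln.
  have c0 : 0 <= (al / S) ^+ 2 by rewrite sqr_ge0.
  apply: (le_trans (ler_wpM2l c0 hV)).
  by apply: le_of_eq; field.
have W0 : 0 <= W2 by apply: sumr_ge0 => j _; exact: sqr_ge0.
have x0 : 0 <= n%:R * W2 / S ^+ 2 by rewrite divr_ge0 ?mulr_ge0 ?sqr_ge0 // ltW.
have y0 : 0 <= k%:R / n%:R :> R by rewrite divr_ge0.
have c1 : 0 <= 8 * al * be / om by rewrite divr_ge0 ?mulr_ge0 // ltW.
have c2 : 0 <= ka * al ^+ 2 by rewrite mulr_ge0 ?sqr_ge0.
rewrite /var_cst; move: head tail c1 c2 x0 y0.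
set C1 := 8 * _ * _ / _; set C2 := ka * _; set xx := n%:R * _ / _; set yy := k%:R / _.
move=> head tail c1 c2 x0 y0.
have := mulr_ge0 c1 x0; have := mulr_ge0 c2 y0; lra.
Qed.

End Variance.
End Risk.

(** * Spectrum of A_k *)

Section Spectrum.
Variables (R : realType) (n p : nat) (X : 'M[R]_(n, p)) (lam : R) (ev : 'rV[R]_p).
Hypothesis n0 : (0 < n)%N.
Hypothesis ev_gt0 : forall j, 0 < ev 0 j.

Definition colnorm (j : 'I_p) : R := inner (X *m delta_mx j (0 : 'I_1)) (X *m delta_mx j 0).

Lemma colnormE j : colnorm j = \sum_i X i j ^+ 2.
Proof. by rewrite /colnorm -colE innerE; apply: eq_bigr => i _; rewrite mxE expr2. Qed.

Lemma trace_Amx_tail k :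
  \sum_i qform (Amx_tail lam X k) (delta_mx i 0) =
  n%:R * lam + \sum_(j < p | (k <= j)%N) colnorm j.
Proof.
have -> : \sum_(j < p | (k <= j)%N) colnorm j =
    \sum_i \sum_(j < p | (k <= j)%N) X i j ^+ 2.
  by rewrite exchange_big; apply: eq_bigr => j _; rewrite colnormE.
have -> : n%:R * lam = \sum_(i < n) lam by rewrite sumr_const card_ord mulr_natl.
rewrite -big_split; apply: eq_bigr => i _; rewrite qform_Amx_tail; congr (_ + _).
  rewrite innerE (bigD1 i) //= big1 => [|j ji]; last by rewrite mxE (negPf ji) mul0r.
  by rewrite !mxE !eqxx mulr1 addr0 mulr1.
by apply: eq_bigr => j _; rewrite -colE !mxE.
Qed.

Lemma inner_delta m (i : 'I_m) : inner (delta_mx i (0 : 'I_1) : 'cV[R]_m) (delta_mx i 0) = 1.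
Proof.
rewrite innerE (bigD1 i) //= big1 => [|j ji]; last by rewrite mxE (negPf ji) mul0r.
by rewrite !mxE !eqxx mulr1 addr0.
Qed.

(** The mean eigenvalue tr A_k / n is known up to constants, and a bounded
    condition number places all eigenvalues within a factor L of it. *)
Lemma spectrum_of_cond k (L S K1 : R) : 0 < L ->
  posdef_cond (Amx_tail lam X k) L ->
  n%:R * (S / 2) <= n%:R * lam + \sum_(j < p | (k <= j)%N) colnorm j <= n%:R * (K1 * S) ->
  forall v, S / (2 * L) * inner v v <= qform (Amx_tail lam X k) v <= L * K1 * S * inner v v.
Proof.
move=> L0 /(posdef_cond_bounds n0)[m0 [m1 [m0p m01 m1L hm]]] /andP[lo hi] v.
have nR : 0 < n%:R :> R by rewrite ltr0n.
have sums : n%:R * m0 <= n%:R * lam + \sum_(j < p | (k <= j)%N) colnorm j <= n%:R * m1.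
  rewrite -trace_Amx_tail -[n in n%:R * m0]card_ord -[n in n%:R * m1]card_ord.
  rewrite !mulr_natl -!sumr_const; apply/andP; split; apply: ler_sum => i _;
  by have := hm (delta_mx i 0); rewrite inner_delta !mulr1 => /andP[].
have /andP[s1 s2] := sums.
have h1 : S / 2 <= m1 by have := le_trans lo s2; rewrite ler_pM2l.
have h2 : m0 <= K1 * S by have := le_trans s1 hi; rewrite ler_pM2l.
have /andP[v1 v2] := hm v; apply/andP; split.
  apply: le_trans v1; rewrite ler_wpM2r ?inner_ge0 //.
  rewrite invfM mulrA ler_pdivrMr //; lra.
apply: (le_trans v2); rewrite ler_wpM2r ?inner_ge0 //.
by apply: (le_trans m1L); rewrite -mulrA ler_pM2l.
Qed.

(** Test the form on the column X_j itself. *)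
Lemma lam_colnorm_le k (m1 : R) (j : 'I_p) : (k <= j)%N -> 0 < colnorm j ->
  (forall v, qform (Amx_tail lam X k) v <= m1 * inner v v) ->
  lam + colnorm j <= m1.
Proof.
move=> kj cj /(_ (X *m delta_mx j 0)); rewrite qform_Amx_tail -/(colnorm j).
rewrite (bigD1 j) //= => h.
rewrite -(ler_pM2r cj) mulrDl; apply: le_trans h; rewrite lerD2l.
have -> : (X^T *m (X *m delta_mx j (0 : 'I_1))) j 0 = colnorm j.
  by rewrite colnormE -colE mxE; apply: eq_bigr => i _; rewrite !mxE expr2.
by rewrite -expr2 lerDl; apply: sumr_ge0 => i _; exact: sqr_ge0.
Qed.

(** The two forms differ by |y|^2, y being the coordinates of X^T v with index in
    [k, kb). By duality |y|^2 = <X y, v> <= |X y| |v|, and X is bounded on the head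
    block. *)
Lemma spectrum_extend k kb (C lk : R) v : (k <= kb)%N -> 0 <= C -> 0 <= lk ->
  (forall r : 'cV[R]_p, (forall j : 'I_p, (kb <= j)%N -> r j 0 = 0) ->
     inner (X *m r) (X *m r) <= C * evnorm ev r) ->
  (forall j : 'I_p, (k <= j)%N -> ev 0 j <= lk) ->
  qform (Amx_tail lam X kb) v <= qform (Amx_tail lam X k) v
    <= qform (Amx_tail lam X kb) v + C * lk * inner v v.
Proof.
move=> kkb C0 lk0 hX hlk; rewrite !qform_Amx_tail.
pose y := X^T *m v; pose r := tailv k (headv kb y).
have rr : inner r r = \sum_(j < p | (k <= j)%N && (j < kb)%N) y j 0 ^+ 2.
  rewrite /r inner_tailvv inner_tailv big_mkcondr; apply: eq_bigr => j _.
  by rewrite [headv _ _ _ _]mxE; case: ifP; rewrite ?expr2 ?mulr0.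
have ry : inner r r = inner y r.
  rewrite rr /r inner_tailv big_mkcondr; apply: eq_bigr => j _.
  by rewrite [headv _ _ _ _]mxE; case: ifP; rewrite ?expr2 ?mulr0.
have -> : \sum_(j < p | (k <= j)%N) (X^T *m v) j 0 ^+ 2 =
   inner r r + \sum_(j < p | (kb <= j)%N) (X^T *m v) j 0 ^+ 2.
  rewrite rr (bigID (fun j : 'I_p => (j < kb)%N)) /=; congr (_ + _).
  apply: eq_bigl => j; rewrite -(leqNgt kb); apply/andP/idP => [[]//|h].
  by split=> //; exact: leq_trans h.
have r0 := inner_ge0 r.
rewrite addrCA lerDr r0 /= addrC lerD2l.
have h1 := inner_CS v (X *m r).
have vr : inner v (X *m r) = inner r r by rewrite inner_mulmx ry.
have h2 : inner (X *m r) (X *m r) <= C * (lk * inner r r).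
  apply: (le_trans (hX r _)).
    by move=> j kj; rewrite /r [tailv _ _ _ _]mxE [headv _ _ _ _]mxE ltnNge kj if_same.
  rewrite ler_wpM2l // /evnorm innerE mulr_sumr; apply: ler_sum => j _.
  rewrite -expr2; case: (leqP k j) => kj; first by rewrite ler_wpM2r ?sqr_ge0 // hlk.
  by rewrite /r [tailv _ _ _ _]mxE leqNgt kj /= expr0n !mulr0.
rewrite vr in h1; have v0 := inner_ge0 v.
have h3 := ler_wpM2l v0 h2.
have [->|rn] := eqVneq (inner r r) 0; first by rewrite !mulr_ge0.
have rp : 0 < inner r r by rewrite lt_neqAle eq_sym rn.
rewrite -(ler_pM2r rp) -expr2; apply: (le_trans h1); apply: (le_trans h3).
by apply: le_of_eq; ring.
Qed.

End Spectrum.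

(** * Conclusions on a good design *)

Lemma ev_nextE (R : realType) p (ev : 'rV[R]_p) k (kp : (k < p)%N) :
  ev_next ev k = ev 0 (Ordinal kp).
Proof. by rewrite /ev_next insubT. Qed.

Section Good.
Variables (R : realType) (n p : nat) (X : 'M[R]_(n, p)) (lam : R) (ev : 'rV[R]_p).
Variables (theta : 'cV[R]_p) (k kb : nat) (gamma L b K : R).
Hypothesis n0 : (0 < n)%N.
Hypothesis ev_ge : forall i j : 'I_p, (i <= j)%N -> ev 0 j <= ev 0 i.
Hypothesis ev_gt0 : forall j, 0 < ev 0 j.
Hypothesis L0 : 0 < L.
Hypothesis b0 : 0 < b.
Hypothesis K0 : 0 < K.
Hypothesis hgamma : 0 <= gamma < 1.
Hypothesis kkb : (k <= kb)%N.
Hypothesis kbp : (kb < p)%N.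
Let kp : (k < p)%N := leq_ltn_trans kkb kbp.
Hypothesis hlam : - gamma * tail_sum ev kb < lam.
Hypothesis hk : k = kb \/ (b < rho n ev lam k /\ kb%:R <= n%:R * (b / 2)).

Let S := lam + tail_sum ev k.
Let g := gamma / (1 - gamma).
(** K1, so that lam + K * tail_sum <= K1 (lam + tail_sum) even if lam is
    negative. *)
Definition trace_cst (K gamma : R) : R := 1 + K / (1 - gamma).
Let K1 := trace_cst K gamma.
Definition upper_cst (K gamma L b : R) : R := L * trace_cst K gamma + 4 * K / b.
Let be := upper_cst K gamma L b.
Definition rho_cst (K gamma L b : R) : R :=
  2 * (L * trace_cst K gamma + gamma / (1 - gamma)) + b^-1.
Let rr := rho_cst K gamma L b.

Let gamma1 : 0 < 1 - gamma.
Proof. by case/andP: hgamma => _; rewrite subr_gt0. Qed.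
Let gamma0 : 0 <= gamma.
Proof. by case/andP: hgamma. Qed.
Let nR : 0 < n%:R :> R. Proof. by rewrite ltr0n. Qed.
Let K1_gt0 : 0 < K1.
Proof. by rewrite /K1 addr_gt0 // divr_gt0. Qed.
Let be_gt0 : 0 < be.
Proof. by rewrite /be addr_gt0 // ?mulr_gt0 // invr_gt0. Qed.
Let g_ge0 : 0 <= g. Proof. by rewrite divr_ge0 // ltW. Qed.
Let rr_gt0 : 0 < rr.
Proof.
rewrite /rr /rho_cst addr_gt0 ?invr_gt0 // mulr_gt0 // -/g.
by apply: (@lt_le_trans _ _ (L * K1)); [rewrite mulr_gt0|rewrite lerDl].
Qed.

Lemma tail_sum_gt0 m : (m < p)%N -> 0 < tail_sum ev m.
Proof.
move=> mp; rewrite /tail_sum (bigD1 (Ordinal mp)) //=.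
by apply: ltr_wpDr => //; apply: sumr_ge0 => j _; rewrite ltW.
Qed.

Lemma tail_sum_le m m' : (m <= m')%N -> tail_sum ev m' <= tail_sum ev m.
Proof.
move=> mm; rewrite /tail_sum !(big_mkcond (fun i : 'I_p => (_ <= i)%N)); apply: ler_sum => j _.
by case: ifP => h; [rewrite (leq_trans mm h)|case: ifP => // _; rewrite ltW].
Qed.

Lemma lam_gt_tail_sum : - gamma * tail_sum ev k < lam.
Proof.
apply: le_lt_trans hlam; rewrite !mulNr lerN2.
by rewrite ler_wpM2l // tail_sum_le.
Qed.

(** A negative lam eats at most the fraction gamma of the tail sum, so
    lam + tail_sum keeps the order of both terms. *)
Lemma scale_bounds m : (m < p)%N -> - gamma * tail_sum ev m < lam ->
  [/\ 0 < lam + tail_sum ev m, - lam <= g * (lam + tail_sum ev m) &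
      tail_sum ev m <= (lam + tail_sum ev m) / (1 - gamma)].
Proof.
move=> mp h; have t0 := tail_sum_gt0 mp.
have h1 : (1 - gamma) * tail_sum ev m < lam + tail_sum ev m by lra.
have h2 : tail_sum ev m <= (lam + tail_sum ev m) / (1 - gamma).
  by rewrite ler_pdivlMr // mulrC ltW.
split=> //; first by apply: lt_trans h1; rewrite mulr_gt0.
have := ler_wpM2l gamma0 h2; rewrite mulrA /g (mulrAC gamma); lra.
Qed.

Lemma S_gt0 : 0 < S.
Proof. by have [] := scale_bounds kp lam_gt_tail_sum. Qed.

Lemma rho_ge c : rr <= c -> n%:R * ev_next ev k <= rr * S -> c^-1 <= rho n ev lam k.
Proof.
move=> rc h; rewrite /rho -/S; have S0 := S_gt0.
have e0 : 0 < ev_next ev k by rewrite (ev_nextE _ kp).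
have c0 : 0 < c by apply: lt_le_trans rc.
rewrite ler_pdivlMr ?mulr_gt0 // [leLHS]mulrC ler_pdivrMr // [leRHS]mulrC.
by apply: (le_trans h); rewrite ler_pM2r.
Qed.

Hypothesis hpd : posdef_cond (Amx_tail lam X kb) L.
Hypothesis hup : \sum_(j < p | (kb <= j)%N) colnorm X j <= K * n%:R * tail_sum ev kb.
Hypothesis hlo : (1 - (1 - gamma) / 2) * n%:R * tail_sum ev kb <=
  \sum_(j < p | (kb <= j)%N) colnorm X j.
Hypothesis hcol : n%:R / 2 * ev 0 (Ordinal kbp) <= colnorm X (Ordinal kbp).
Hypothesis hiso : forall r : 'cV[R]_p, (forall l : 'I_p, (kb <= l)%N -> r l 0 = 0) ->
  n%:R / 32 * evnorm ev r <= inner (X *m r) (X *m r) <= 4 * K * n%:R * evnorm ev r.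

(** The deviation allowed for the lower bound on the trace is the fraction
    (1 - gamma) / 2 of the tail sum, half of what is certain to remain of it after
    adding lam. *)
Lemma spectrum_kb v : (lam + tail_sum ev kb) / (2 * L) * inner v v
   <= qform (Amx_tail lam X kb) v <= L * K1 * (lam + tail_sum ev kb) * inner v v.
Proof.
have [s0 s1 s2] := scale_bounds kbp hlam.
apply: spectrum_of_cond => //; apply/andP; split.
  have hlo' := hlo; rewrite -(lerD2l (n%:R * lam)) in hlo'; apply: le_trans hlo'.
  have -> : n%:R * lam + (1 - (1 - gamma) / 2) * n%:R * tail_sum ev kb =
     n%:R * (lam + (1 - (1 - gamma) / 2) * tail_sum ev kb) by ring.
  rewrite ler_pM2l //.
  have : (1 - gamma) * tail_sum ev kb <= lam + tail_sum ev kb by rewrite mulrC -ler_pdivlMr.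
  lra.
apply: (@le_trans _ _ (n%:R * (lam + K * tail_sum ev kb))).
  by rewrite mulrDr lerD2l (le_trans hup) // mulrCA mulrA.
rewrite ler_pM2l // /K1 /trace_cst.
have t0 := tail_sum_gt0 kbp.
have := ler_wpM2l (ltW K0) s2; lra.
Qed.

(** Column kb alone forces the largest eigenvalue above lam + n lambda / 2. *)
Lemma rho_upper_kb : n%:R * ev 0 (Ordinal kbp) <=
  2 * (L * K1 + g) * (lam + tail_sum ev kb).
Proof.
have [s0 s1 s2] := scale_bounds kbp hlam.
have c0 : 0 < colnorm X (Ordinal kbp).
  by apply: lt_le_trans hcol; rewrite !mulr_gt0 // invr_gt0.
have h v : qform (Amx_tail lam X kb) v <= L * K1 * (lam + tail_sum ev kb) * inner v v.
  by have /andP[] := spectrum_kb v.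
have := @lam_colnorm_le _ _ _ X lam kb _ (Ordinal kbp) (leqnn kb) c0 h.
have := hcol; lra.
Qed.

(** If k = kb this is spectrum_kb and rho_upper_kb. If k = k* < kb, then rho_k > b
    says that n lambda_(k+1) < S / b. Hence the columns from k to kb raise the
    largest eigenvalue by O(S) only, and, since kb <= n b / 2, they carry at most
    half of S, so that the smallest eigenvalue is still of order S. *)
Lemma spectrum_k : (forall v, S / (4 * L) * inner v v
   <= qform (Amx_tail lam X k) v <= be * S * inner v v) /\
   n%:R * ev_next ev k <= rr * S.
Proof.
have [sb0 sb1 sb2] := scale_bounds kbp hlam.
have S0 := S_gt0.
have L2 : 0 < L^-1 by rewrite invr_gt0.
have ib : 0 < b^-1 by rewrite invr_gt0.
rewrite (ev_nextE _ kp); case: (hk) => [kE|[hr hkb]].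
  have SE : lam + tail_sum ev kb = S by rewrite /S kE.
  split.
    move=> v; rewrite kE; have /andP[h1 h2] := spectrum_kb v; rewrite SE in h1 h2.
    have v0 := inner_ge0 v; apply/andP; split.
      apply: le_trans h1; rewrite ler_wpM2r // ler_wpM2l ?(ltW S0) //.
      by rewrite lef_pV2 ?posrE ?mulr_gt0 // ler_pM2r //; lra.
    apply: (le_trans h2); rewrite ler_wpM2r // ler_wpM2r ?(ltW S0) //.
    by rewrite /be /upper_cst lerDl mulr_ge0 ?mulr_ge0 // ltW.
  have -> : ev 0 (Ordinal kp) = ev 0 (Ordinal kbp) by congr (ev 0 _); apply: val_inj.
  apply: (le_trans rho_upper_kb); rewrite SE ler_wpM2r ?(ltW S0) //.
  by rewrite /rr /rho_cst lerDl ltW.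
set lk := ev 0 (Ordinal kp).
have lk0 : 0 < lk by exact: ev_gt0.
have hlk : forall j : 'I_p, (k <= j)%N -> ev 0 j <= lk by move=> j kj; exact: ev_ge.
have nl : n%:R * lk <= S / b.
  rewrite ler_pdivlMr // mulrC ltW // -ltr_pdivlMr ?mulr_gt0 //.
  by move: hr; rewrite /rho (ev_nextE _ kp).
have SSb : S <= 2 * (lam + tail_sum ev kb).
  suff : tail_sum ev k <= tail_sum ev kb + S / 2 by rewrite /S; lra.
  have -> : tail_sum ev k = tail_sum ev kb + \sum_(j < p | (k <= j)%N && (j < kb)%N) ev 0 j.
    rewrite addrC /tail_sum (bigID (fun j : 'I_p => (j < kb)%N)) /=; congr (_ + _).
    apply: eq_bigl => j; rewrite -(leqNgt kb); apply/andP/idP => [[]//|h].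
    by split=> //; exact: leq_trans h.
  rewrite lerD2l; apply: (@le_trans _ _ (\sum_(j < p | (j < kb)%N) lk)).
    rewrite big_mkcond [leRHS]big_mkcond; apply: ler_sum => j _.
    by case: (leqP k j) => kj /=; case: ifP => // _; [exact: hlk|exact: ltW].
  rewrite -(sum_head_ord kb (fun=> lk)) sumr_const card_ord -[leLHS]mulr_natl.
  apply: (@le_trans _ _ (kb%:R * lk)); first by rewrite ler_wpM2r ?(ltW lk0) // ler_nat geq_minl.
  apply: (le_trans (ler_wpM2r (ltW lk0) hkb)).
  have -> : n%:R * (b / 2) * lk = b / 2 * (n%:R * lk) by ring.
  have -> : S / 2 = b / 2 * (S / b) by field; rewrite gt_eqF.
  by rewrite ler_pM2l // divr_gt0.
have SbS : lam + tail_sum ev kb <= S by rewrite /S lerD2l tail_sum_le.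
split; last first.
  apply: (le_trans nl); rewrite mulrC ler_wpM2r ?(ltW S0) //.
  by rewrite /rr /rho_cst lerDr mulr_ge0 // addr_ge0 // ltW // mulr_gt0.
move=> v; have v0 := inner_ge0 v.
have hC : forall r : 'cV[R]_p, (forall j : 'I_p, (kb <= j)%N -> r j 0 = 0) ->
     inner (X *m r) (X *m r) <= 4 * K * n%:R * evnorm ev r.
  by move=> r /hiso/andP[].
have C0 : 0 <= 4 * K * n%:R by rewrite !mulr_ge0 // ltW.
have /andP[e1 e2] := spectrum_extend lam v kkb C0 (ltW lk0) hC hlk.
have /andP[h1 h2] := spectrum_kb v; apply/andP; split.
  apply: le_trans e1; apply: le_trans h1; rewrite ler_wpM2r //.
  rewrite ler_pdivrMr ?mulr_gt0 //.
  rewrite (_ : _ / _ * _ = 2 * (lam + tail_sum ev kb)) //.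
  by field; rewrite gt_eqF.
apply: (le_trans e2); apply: (le_trans (lerD h2 (lexx _))).
rewrite -mulrDl ler_wpM2r //.
rewrite [leRHS](_ : _ = L * K1 * S + 4 * K / b * S); last by rewrite /be /upper_cst mulrDl.
apply: lerD.
  by rewrite ler_wpM2l // ltW // mulr_gt0.
rewrite -mulrA; have -> : 4 * K / b * S = 4 * K * (S / b) by ring.
by rewrite ler_pM2l // mulr_gt0.
Qed.

Definition lower_cst (L : R) : R := 4 * L.

Lemma posdef_cond_k : posdef_cond (Amx_tail lam X k) (lower_cst L * be).
Proof.
have [hs _] := spectrum_k; have S0 := S_gt0.
apply: (posdef_condP n0 _ (Amx_tail_sym _ _ _) hs).
  by rewrite divr_gt0 // mulr_gt0.
rewrite /lower_cst le_eqVlt; apply/orP; left; apply/eqP; field.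
by rewrite !gt_eqF.
Qed.

Hypothesis hth : inner (X *m tailv k theta) (X *m tailv k theta) <=
  K * n%:R * \sum_(j < p | (k <= j)%N) ev 0 j * theta j 0 ^+ 2.
Hypothesis hvar : \sum_(j < p | (k <= j)%N) ev 0 j * colnorm X j <=
  K * n%:R * tail_sum2 ev k.

Lemma mnorm_sqr m (M : 'M[R]_m) v : 0 <= qform M v -> mnorm M v ^+ 2 = qform M v.
Proof. by move=> h; rewrite /mnorm sqr_sqrtr. Qed.

Lemma qform_diag m (d : 'rV[R]_m) v : qform (diag_mx d) v = \sum_j d 0 j * v j 0 ^+ 2.
Proof.
rewrite qformE innerE; apply: eq_bigr => j _.
by rewrite mul_diag_mx [X in _ * X]mxE; ring.
Qed.

Lemma qform_diag_ge0 m (d : 'rV[R]_m) v : (forall j, 0 <= d 0 j) -> 0 <= qform (diag_mx d) v.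
Proof. by move=> h; rewrite qform_diag; apply: sumr_ge0 => j _; rewrite mulr_ge0 ?sqr_ge0. Qed.

Lemma bias_boundE : bias_bound n ev lam theta k =
  \sum_(j < p | (k <= j)%N) ev 0 j * theta j 0 ^+ 2 +
  (\sum_(j < p | (j < k)%N) theta j 0 ^+ 2 / ev 0 j) * (S / n%:R) ^+ 2.
Proof.
rewrite /bias_bound -/S; congr (_ + _ * _).
  rewrite mnorm_sqr; last by apply: qform_diag_ge0 => j; rewrite mxE ltW.
  rewrite qform_diag -(sum_tail_ord k (fun j => ev 0 j * theta j 0 ^+ 2)).
  by apply: eq_bigr => j _; rewrite !mxE.
have -> : invmx (Sigma_head ev k) =
    diag_mx (\row_j (ev 0 (head_ord j))^-1 : 'rV[R]_(minn k p)).
  have E : Sigma_head ev k *m diag_mx (\row_j (ev 0 (head_ord j))^-1 : 'rV[R]_(minn k p)) = 1%:M.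
    rewrite mulmx_diag; apply/matrixP => i j; rewrite !mxE.
    by case: eqVneq => [->|_] //; rewrite ?mulr1n mulfV // gt_eqF.
  have [Eu _] := mulmx1_unit E.
  by rewrite -[RHS](mulKmx Eu) E mulmx1.
rewrite mnorm_sqr; last by apply: qform_diag_ge0 => j; rewrite mxE invr_ge0 ltW.
rewrite qform_diag -(sum_head_ord k (fun j => theta j 0 ^+ 2 / ev 0 j)).
by apply: eq_bigr => j _; rewrite !mxE mulrC.
Qed.

Let al := lower_cst L.
Definition bias_total_cst (K gamma L b : R) : R :=
  bias_cst (lower_cst L) (upper_cst K gamma L b) 32^-1 K (rho_cst K gamma L b) (gamma / (1 - gamma)).
Definition var_total_cst (K gamma L b : R) : R :=
  var_cst (lower_cst L) (upper_cst K gamma L b) 32^-1 K.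

Lemma risk_k (c : R) : 0 < c -> bias_total_cst K gamma L b <= c -> var_total_cst K gamma L b <= c ->
  (bias ev lam theta X * (c^-1)%:E <= (bias_bound n ev lam theta k)%:E)%E /\
  (variance_term ev lam X * (c^-1)%:E <= (variance_bound n ev lam k)%:E)%E.
Proof.
move=> c0 hbc hvc; have [hs hr] := spectrum_k; have S0 := S_gt0.
have al0 : 0 < al by rewrite /al /lower_cst mulr_gt0.
have om0 : 0 < 32^-1 :> R by rewrite invr_gt0.
have [_ hl _] := scale_bounds kp lam_gt_tail_sum.
have hX' : forall r : 'cV[R]_p, (forall j : 'I_p, (k <= j)%N -> r j 0 = 0) ->
   32^-1 * n%:R * evnorm ev r <= inner (X *m r) (X *m r).
  move=> r h; have /andP[] := hiso (r := r) (fun l kl => h l (leq_trans kkb kl)).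
  by rewrite (mulrC n%:R).
have hlk : forall j : 'I_p, (k <= j)%N -> ev 0 j <= ev_next ev k.
  by move=> j kj; rewrite (ev_nextE _ kp); exact: ev_ge.
have Au : Amx lam X \in unitmx := Amx_unitmx_tail S0 al0 hs.
split.
- rewrite /bias Au -EFinM lee_fin ler_pdivrMr // mnorm_sqr; last first.
    by apply: qform_diag_ge0 => j; rewrite ltW.
  have := bias_sum_le n0 ev_gt0 S0 al0 be_gt0 om0 (ltW K0) g_ge0 hs hX' hl hlk hr (ltW rr_gt0) hth.
  rewrite bias_boundE -/(bias_total_cst K gamma L b) => h; apply: (le_trans h).
  rewrite mulrC ler_wpM2l // addr_ge0 //.
    by apply: sumr_ge0 => j _; rewrite mulr_ge0 ?sqr_ge0 // ltW.
  by rewrite mulr_ge0 ?sqr_ge0 // sumr_ge0 // => j _; rewrite divr_ge0 ?sqr_ge0 // ltW.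
- rewrite /variance_term Au -EFinM lee_fin ler_pdivrMr //.
  have := var_sum_le n0 ev_gt0 S0 al0 be_gt0 om0 (ltW K0) hs hX' hvar.
  rewrite -/(var_total_cst K gamma L b) => h; apply: (le_trans h).
  rewrite mulrC ler_wpM2l // /variance_bound -/S; apply: addr_ge0; first by rewrite divr_ge0.
  apply: divr_ge0; last by rewrite exprn_ge0 // ltW.
  by apply: mulr_ge0 => //; apply: sumr_ge0 => j _; exact: sqr_ge0.
Qed.

End Good.

(** * Probability of a good design *)

Section Event.
Context (R : realType) (n p : nat) (ev : 'rV[R]_p)
  (d0 : measure_display) (T0 : measurableType d0) (P0 : probability T0 R)
  (x : T0 -> 'cV[R]_p)
  (d : measure_display) (T : measurableType d) (P : probability T R)
  (X : T -> 'M[R]_(n, p)) (sigma tau : R).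
Hypothesis ev_gt0 : forall i : 'I_p, 0 < ev 0 i.
Hypothesis hx : measurable_fun [set: T0] (x : T0 -> borelM R p 1).
Hypothesis hx_cov : second_moment P0 x (Sigma ev).
Hypothesis hX : measurable_fun [set: T] (X : T -> borelM R n p).
Hypothesis hX_indep : mutually_independent P
       (fun (i : 'I_n) (w : T) => (row i (X w))^T : borelM R p 1).
Hypothesis hX_law : forall i : 'I_n,
  same_law P P0 (fun w => (row i (X w))^T : borelM R p 1) (x : T0 -> borelM R p 1).
Hypothesis hZ : forall i : 'I_n,
  (psi2_norm_vec P (fun w => (row i (X w *m Sigma_invsqrt ev))^T) <= sigma%:E)%E.
Hypothesis st : sigma < tau.
Hypothesis tau0 : 0 < tau.
Variables (theta : 'cV[R]_p) (k kb N : nat) (eta c2 : R).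
Hypothesis kbp : (kb < p)%N.
Let K := 2 * tau ^+ 2.
Hypothesis eta0 : 0 < eta.
Hypothesis N2 : (2 <= N)%N.
Hypothesis NK : 128 * K <= N%:R ^+ 2.
Hypothesis c2_gt0 : 0 < c2.
Hypothesis c2_1 : c2 <= 1.
Hypothesis c2_2 : c2 <= (128 * tau ^+ 4)^-1.
Hypothesis c2_3 : c2 <= eta ^+ 2 / (32 * tau ^+ 4).
Hypothesis kbn : N.+2%:R * kb%:R <= n%:R * (c2 / 2).

Let p0 : (0 < p)%N := leq_ltn_trans (leq0n kb) kbp.

Lemma sum_unit (F : unit -> R) : \sum_a F a = F tt.
Proof. by rewrite (big_pred1 tt) //; case. Qed.

Lemma evnorm_delta (j : 'I_p) : evnorm ev (delta_mx j 0) = ev 0 j.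
Proof.
rewrite /evnorm (bigD1 j) //= big1 => [|i ij]; last by rewrite mxE (negPf ij) expr0n mulr0.
by rewrite mxE !eqxx expr1n mulr1 addr0.
Qed.

Lemma evnorm_scaled (s : R) (j : 'I_p) :
  evnorm ev (s *: delta_mx j (0 : 'I_1)) = s ^+ 2 * ev 0 j.
Proof. by rewrite evnormZ evnorm_delta. Qed.

Lemma inner_scaled (M : 'M[R]_(n, p)) (s : R) (j : 'I_p) :
  inner (M *m (s *: delta_mx j (0 : 'I_1))) (M *m (s *: delta_mx j 0)) = s ^+ 2 * colnorm M j.
Proof. by rewrite -scalemxAr innerZl innerZr mulrA -expr2. Qed.

(** What the deterministic part uses about the design besides the condition
    number: two-sided trace bounds at kb, one column bounded below, the head block
    bounded on both sides, and upper bounds for the tails of theta and of Sigma^2. *)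
Definition design_event (M : 'M[R]_(n, p)) : Prop :=
  [/\ \sum_(j < p | (kb <= j)%N) colnorm M j <= K * n%:R * tail_sum ev kb /\
      (1 - eta) * n%:R * tail_sum ev kb <= \sum_(j < p | (kb <= j)%N) colnorm M j,
      n%:R / 2 * ev 0 (Ordinal kbp) <= colnorm M (Ordinal kbp),
      forall r : 'cV[R]_p, (forall l : 'I_p, (kb <= l)%N -> r l 0 = 0) ->
        n%:R / 32 * evnorm ev r <= inner (M *m r) (M *m r) <= 4 * K * n%:R * evnorm ev r,
      inner (M *m tailv k theta) (M *m tailv k theta) <=
        K * n%:R * \sum_(j < p | (k <= j)%N) ev 0 j * theta j 0 ^+ 2 &
      \sum_(j < p | (k <= j)%N) ev 0 j * colnorm M j <= K * n%:R * tail_sum2 ev k].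

(** Five events of failure probability at most exp (- n c2), counted with
    exp (- n c2 / 2), and the head isometry, where half of the exponent pays for
    the cardinality of the net, at most exp ((N + 2) kb). *)
Lemma design_event_prob :
  with_prob P (1 - 7 * expR (- (n%:R * (c2 / 2)))) [set w | design_event (X w)].
Proof.
set e := expR _.
have n0 : 0 <= n%:R :> R by [].
have le_e c : c2 <= c -> expR (- (n%:R * c)) <= e.
  by move=> h; rewrite ler_expR lerN2; apply: ler_wpM2l => //; apply: le_trans h; move: c2_gt0; lra.
have e1 : expR (- n%:R) <= e by rewrite -[n%:R]mulr1 le_e.
have up (I : finType) (r : I -> 'cV[R]_p) :
    with_prob P (1 - e) [set w | \sum_a inner (X w *m r a) (X w *m r a) <=
                             K * n%:R * \sum_a evnorm ev (r a)].
  by apply: with_prob_le (quad_upper p0 ev_gt0 hX hX_indep hZ st tau0 r); rewrite lerD2l lerN2.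
have lo (I : finType) (r : I -> 'cV[R]_p) t : 0 < t -> c2 <= t ^+ 2 / (32 * tau ^+ 4) ->
    with_prob P (1 - e) [set w | (1 - t) * n%:R * \sum_a evnorm ev (r a) <=
                             \sum_a inner (X w *m r a) (X w *m r a)].
  move=> t0 /le_e h.
  apply: with_prob_le (quad_lower p0 ev_gt0 hx hx_cov hX hX_indep hX_law hZ st tau0 r t0).
  by rewrite lerD2l lerN2.
pose r1 (a : 'I_p) : 'cV[R]_p := (if (kb <= a)%N then 1 else 0) *: delta_mx a (0 : 'I_1).
pose r4 (a : 'I_p) : 'cV[R]_p :=
  (if (k <= a)%N then Num.sqrt (ev 0 a) else 0) *: delta_mx a (0 : 'I_1).
pose r5 (_ : unit) : 'cV[R]_p := delta_mx (Ordinal kbp) (0 : 'I_1).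
pose r3 (_ : unit) : 'cV[R]_p := tailv k theta.
have half0 : 0 < 2^-1 :> R by rewrite invr_gt0.
(* The value 1/2 of the deviation turns 32 into 128. *)
have half2 : c2 <= 2^-1 ^+ 2 / (32 * tau ^+ 4).
  rewrite (_ : _ / _ = (128 * tau ^+ 4)^-1) //; field; by rewrite gt_eqF.
have iso : with_prob P (1 - 2 * e) [set w | forall r : 'cV[R]_p,
    (forall l : 'I_p, (kb <= l)%N -> r l 0 = 0) ->
     n%:R / 32 * evnorm ev r <= inner (X w *m r) (X w *m r) <= 4 * K * n%:R * evnorm ev r].
  apply: with_prob_le (head_isometry p0 ev_gt0 hx hx_cov hX hX_indep hX_law hZ st tau0 kb N2 NK).
  rewrite lerD2l lerN2; pose f := expR (- (n%:R * c2)).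
  have f1 : expR (- n%:R) <= f.
    by rewrite ler_expR lerN2 -[leRHS]mulr1 ler_wpM2l.
  have f2 : expR (- (n%:R / (128 * tau ^+ 4))) <= f.
    by rewrite ler_expR lerN2 ler_wpM2l.
  have e2 : 2 <= expR 1 :> R by have := @expR_ge1Dx R 1; lra.
  have M1 : (2 ^+ N.+2) ^+ minn kb p <= expR (n%:R * (c2 / 2)).
    apply: (@le_trans _ _ (expR (N.+2%:R * kb%:R))); last by rewrite ler_expR.
    have -> : N.+2%:R * kb%:R = (N.+2 * kb)%:R * 1 :> R by rewrite natrM mulr1.
    rewrite -exprM expRM_natl.
    apply: (@le_trans _ _ (expR 1 ^+ (N.+2 * minn kb p))).
      by apply: lerXn2r; rewrite ?nnegrE ?expR_ge0.
    by apply: ler_weXn2l; [lra|rewrite leq_mul2l geq_minl orbT].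
  have f0 : 0 <= 2 * f by rewrite mulr_ge0 ?expR_ge0.
  apply: (@le_trans _ _ (expR (n%:R * (c2 / 2)) * (2 * f))).
    apply: ler_pM; [by do 2 apply: exprn_ge0|by rewrite addr_ge0 ?expR_ge0|exact: M1|].
    by lra.
  rewrite mulrCA /f -expRD /e le_eqVlt; apply/orP; left; apply/eqP.
  by congr (_ * expR _); lra.
have := with_probI (with_probI (with_probI (up _ r1) (lo _ r1 _ eta0 c2_3))
  (with_probI (lo _ r5 _ half0 half2) iso)) (with_probI (up _ r3) (up _ r4)).
rewrite (_ : e + e + (e + 2 * e) + (e + e) = 7 * e); last by ring.
apply: with_prob_sub => w /= [[[A1 A2] [A3 A4]] [A5 A6]].
have E1 : \sum_a evnorm ev (r1 a) = tail_sum ev kb.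
  rewrite /tail_sum [RHS]big_mkcond; apply: eq_bigr => a _; rewrite evnorm_scaled.
  by case: ifP; rewrite ?expr1n ?mul1r ?expr0n ?mul0r.
have E2 : \sum_a inner (X w *m r1 a) (X w *m r1 a) = \sum_(j < p | (kb <= j)%N) colnorm (X w) j.
  rewrite [RHS]big_mkcond; apply: eq_bigr => a _; rewrite inner_scaled.
  by case: ifP; rewrite ?expr1n ?mul1r ?expr0n ?mul0r.
have E3 : \sum_a evnorm ev (r4 a) = tail_sum2 ev k.
  rewrite /tail_sum2 [RHS]big_mkcond; apply: eq_bigr => a _; rewrite evnorm_scaled.
  by case: ifP; rewrite ?sqr_sqrtr ?expr0n ?mul0r -?expr2 // ltW.
have E4 : \sum_a inner (X w *m r4 a) (X w *m r4 a) =
    \sum_(j < p | (k <= j)%N) ev 0 j * colnorm (X w) j.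
  rewrite [RHS]big_mkcond; apply: eq_bigr => a _; rewrite inner_scaled.
  by case: ifP; rewrite ?sqr_sqrtr ?expr0n ?mul0r // ltW.
rewrite !sum_unit in A3 A5; rewrite E1 E2 in A1 A2; rewrite E3 E4 in A6.
split=> //.
- by move: A3; rewrite /r5 evnorm_delta -/(colnorm _ _); lra.
- move: A5; rewrite /r3 => /le_trans; apply; apply: le_of_eq.
  congr (_ * _); rewrite /evnorm [RHS]big_mkcond; apply: eq_bigr => j _; rewrite mxE.
  by case: ifP => //; rewrite expr0n mulr0.
Qed.
End Event.

(** * The theorem *)

Unset Implicit Arguments.
Set Strict Implicit.
Set Printing Implicit Defensive.

Theorem theorem1 (R : realType) (sigma_x b gamma L : R)
    (hsigma : 0 < sigma_x) (hb : 0 < b) (hgamma : 0 <= gamma < 1) (hL : 0 < L) :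
  exists c c' L' : R, [/\ 0 < c, 0 < c', 0 < L' &
  forall (n p : nat) (hn : (0 < n)%N) (hnp : (n < p)%N)
    (ev : 'rV[R]_p)
    (hev_ge : forall i j : 'I_p, (i <= j)%N -> ev 0 j <= ev 0 i)
    (hev_gt0 : forall i : 'I_p, 0 < ev 0 i)
    (* the random vector x *)
    (d0 : measure_display) (T0 : measurableType d0) (P0 : probability T0 R)
    (x : T0 -> 'cV[R]_p)
    (hx : measurable_fun [set: T0] (x : T0 -> borelM R p 1))
    (hx_mean : mean_zero P0 x)
    (hx_cov : second_moment P0 x (Sigma ev))
    (* the random matrix X, with i.i.d. rows distributed as x^T *)
    (d : measure_display) (T : measurableType d) (P : probability T R)
    (X : T -> 'M[R]_(n, p))
    (hX : measurable_fun [set: T] (X : T -> borelM R n p))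
    (hX_indep : mutually_independent P
       (fun (i : 'I_n) (w : T) => (row i (X w))^T : borelM R p 1))
    (hX_law : forall i : 'I_n,
       same_law P P0 (fun w => (row i (X w))^T : borelM R p 1)
                     (x : T0 -> borelM R p 1))
    (* the rows of Z = X Sigma^(-1/2) are sub-Gaussian *)
    (hZ : forall i : 'I_n,
       (psi2_norm_vec P (fun w => (row i (X w *m Sigma_invsqrt ev))^T)
          <= sigma_x%:E)%E)
    (lam : R) (theta : 'cV[R]_p)
    (kbar : nat) (hkbar : kbar%:R < n%:R / c)
    (delta : R) (hdelta : 0 <= delta < 1 - c * expR (- (n%:R / c)))
    (hlam : - gamma * tail_sum ev kbar < lam)
    (hA : with_prob P (1 - delta)
            [set w | posdef_cond (Amx_tail lam (X w) kbar) L]),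
  let k := min_kstar kbar (kstar n ev lam b) in
  [/\ with_prob P (1 - c * expR (- (n%:R / c)) - delta)
        [set w | (bias ev lam theta (X w) * (c^-1)%:E
                    <= (bias_bound n ev lam theta k)%:E)%E /\
                 (variance_term ev lam (X w) * (c^-1)%:E
                    <= (variance_bound n ev lam k)%:E)%E],
      c^-1 <= rho n ev lam k,
      - gamma * tail_sum ev k < lam &
      with_prob P (1 - delta - c' * expR (- (n%:R / c')))
        [set w | posdef_cond (Amx_tail lam (X w) k) L']]].
Proof.
case/andP: (hgamma) => gamma0 gamma1.
pose tau := 2 * sigma_x; pose K := 2 * tau ^+ 2; pose eta := (1 - gamma) / 2.
have tau0 : 0 < tau by rewrite mulr_gt0.
have st : sigma_x < tau by rewrite /tau; lra.
have K0 : 0 < K by rewrite mulr_gt0 // exprn_gt0.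
have eta0 : 0 < eta by rewrite divr_gt0 // subr_gt0.
pose N := (Num.truncn (128 * K)).+2.
have N2 : (2 <= N)%N by [].
have NK : 128 * K <= N%:R ^+ 2.
  have h : 128 * K <= N%:R.
    have /andP[_ /ltW h] : (Num.truncn (128 * K))%:R <= 128 * K < (Num.truncn (128 * K)).+1%:R.
      by rewrite truncn_itv // mulr_ge0 // ltW.
    by apply: (le_trans h); rewrite ler_nat.
  apply: (le_trans h); rewrite expr2 ler_peMr // ler1n //.
(* c2 is the smallest of the exponents in the tail bounds. *)
pose c2 := Num.min (Num.min 1 (128 * tau ^+ 4)^-1) (eta ^+ 2 / (32 * tau ^+ 4)).
have t4 : 0 < tau ^+ 4 by rewrite exprn_gt0.
have c2_gt0 : 0 < c2.
  by rewrite !lt_min ltr01 invr_gt0 mulr_gt0 //= divr_gt0 ?exprn_gt0 // mulr_gt0.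
have c2_1 : c2 <= 1 by rewrite !ge_min lexx.
have c2_2 : c2 <= (128 * tau ^+ 4)^-1 by rewrite !ge_min lexx orbT.
have c2_3 : c2 <= eta ^+ 2 / (32 * tau ^+ 4) by rewrite !ge_min lexx !orbT.
pose rr := rho_cst K gamma L b; pose be := upper_cst K gamma L b.
have T0 : 0 < trace_cst K gamma by rewrite addr_gt0 // divr_gt0 // subr_gt0.
have be0 : 0 < be by rewrite addr_gt0 ?mulr_gt0 ?divr_gt0 ?mulr_gt0 ?invr_gt0.
have rr0 : 0 <= rr.
  have h1 : 0 <= gamma / (1 - gamma) by rewrite divr_ge0 // subr_ge0 ltW.
  have h2 : 0 < L * trace_cst K gamma by rewrite mulr_gt0.
  have h3 : 0 < b^-1 by rewrite invr_gt0.
  by rewrite /rr /rho_cst; lra.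
(* The last three terms make kbar < n / c yield kbar <= n b / 2 and
   (N + 2) kbar <= n c2 / 2, and 1 / c <= c2 / 2. *)
pose c := 8 + rr + `|bias_total_cst K gamma L b| + `|var_total_cst K gamma L b| + 2 / b +
          2 * N.+2%:R / c2 + 2 / c2.
have b2 : 0 < 2 / b by rewrite divr_gt0.
have M0 : 0 < 2 * N.+2%:R / c2 by rewrite divr_gt0 // mulr_gt0.
have c20 : 0 < 2 / c2 by rewrite divr_gt0.
have nb := normr_ge0 (bias_total_cst K gamma L b).
have nv := normr_ge0 (var_total_cst K gamma L b).
have bc := ler_norm (bias_total_cst K gamma L b).
have vc := ler_norm (var_total_cst K gamma L b).
have cge : [/\ 8 <= c, rr <= c, bias_total_cst K gamma L b <= c, var_total_cst K gamma L b <= c &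
  [/\ 2 / b <= c, 2 * N.+2%:R / c2 <= c & 2 / c2 <= c]].
  rewrite /c; move: nb nv bc vc b2 M0 c20 rr0.
  move: (bias_total_cst _ _ _ _) (var_total_cst _ _ _ _) (2 / b) (2 * _ / c2) (2 / c2) => B V y1 y2 y3.
  by move=> *; split; [| | | |split]; lra.
have [c8 crr cB cV [cb cM cc]] := cge.
have c0 : 0 < c by lra.
exists c, c, (lower_cst L * be); split => //; first by rewrite mulr_gt0 // mulr_gt0.
move=> n p hn hnp ev hev_ge hev_gt0 d0 T0' P0 x hx hx_mean hx_cov d T P X hX hX_indep hX_law hZ
  lam theta kbar hkbar delta hdelta hlam hA k.
have nR : 0 < n%:R :> R by rewrite ltr0n.
have kn a : 0 < a -> a^-1 <= c -> kbar%:R <= n%:R * a.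
  move=> a0 h; apply: (le_trans (ltW hkbar)); rewrite ler_pM2l //.
  by rewrite -[leRHS]invrK lef_pV2 // posrE invr_gt0.
have kbp : (kbar < p)%N.
  apply: leq_ltn_trans hnp; rewrite -(ler_nat R) -[leRHS]mulr1 kn // invr1; lra.
have kkb : (k <= kbar)%N.
  by rewrite /k /min_kstar; case: kstar => // j; exact: geq_minl.
have hk : k = kbar \/ (b < rho n ev lam k /\ kbar%:R <= n%:R * (b / 2)).
  rewrite /k /min_kstar /kstar; case: pickP => [j /andP[bj _]|_]; last by left.
  have [kj|jk] := leqP kbar j; first by left.
  right; split=> //.
  by apply: kn; [rewrite divr_gt0|rewrite invf_div].
have kbn : N.+2%:R * kbar%:R <= n%:R * (c2 / 2).
  have h : kbar%:R <= n%:R * (c2 / (2 * N.+2%:R)).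
    by apply: kn; [rewrite divr_gt0 // mulr_gt0|rewrite invf_div].
  have Nn : 0 <= N.+2%:R :> R by [].
  apply: (le_trans (ler_wpM2l Nn h)).
  by apply: le_of_eq; field; rewrite gt_eqF.
have hE := design_event_prob hev_gt0 hx hx_cov hX hX_indep hX_law hZ st tau0 theta k kbp
  eta0 N2 NK c2_gt0 c2_1 c2_2 c2_3 kbn.
have e7 : 7 * expR (- (n%:R * (c2 / 2))) <= c * expR (- (n%:R / c)).
  apply: ler_pM => //; rewrite ?expR_ge0 //; first by lra.
  rewrite ler_expR lerN2 ler_pM2l // -[leRHS]invrK lef_pV2 ?posrE ?invr_gt0 ?divr_gt0 //.
  by rewrite invf_div.
have good := with_probI hA hE.
have conc w : posdef_cond (Amx_tail lam (X w) kbar) L ->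
  design_event ev tau theta k eta kbp (X w) ->
  [/\ (bias ev lam theta (X w) * (c^-1)%:E <= (bias_bound n ev lam theta k)%:E)%E /\
      (variance_term ev lam (X w) * (c^-1)%:E <= (variance_bound n ev lam k)%:E)%E,
      c^-1 <= rho n ev lam k & posdef_cond (Amx_tail lam (X w) k) (lower_cst L * be)].
  move=> h1 [[h2 h3] h4 h5 h6 h7].
  split.
  - exact: (risk_k hn hev_ge hev_gt0 hL hb K0 hgamma kkb hlam hk h1 h2 h3 h4 h5 h6 h7 c0 cB cV).
  - have [_ h8] := spectrum_k hn hev_ge hev_gt0 hL hb K0 hgamma kkb hlam hk h1 h2 h3 h4 h5.
    exact: (rho_ge hn hev_gt0 hL hb K0 hgamma kkb kbp hlam crr h8).
  - exact: (posdef_cond_k hn hev_ge hev_gt0 hL hb K0 hgamma kkb hlam hk h1 h2 h3 h4 h5).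
(* rho is deterministic, so one good outcome proves its bound; 1 - delta > c e^(-n/c)
   provides it. *)
have [w0 [g1 g2]] : [set w | posdef_cond (Amx_tail lam (X w) kbar) L] `&`
    [set w | design_event ev tau theta k eta kbp (X w)] !=set0.
  by apply: with_prob_nonempty good; case/andP: hdelta => _ h; lra.
split.
- apply: with_prob_le (with_prob_sub _ good); first by lra.
  by move=> w [/= h1 h2]; have [] := conc w h1 h2.
- by have [] := conc w0 g1 g2.
- exact: (lam_gt_tail_sum hev_gt0 hgamma kkb hlam).
- apply: with_prob_le (with_prob_sub _ good); first by lra.
  by move=> w [/= h1 h2]; have [] := conc w h1 h2.
Qed.
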